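(* Let $w=\log_2 7$. There is a parallel algorithm (called Strassen-S) in the binary-forking model without locks and atomic instructions that, given two $n\times n$ matrices $U,V$ ($n$ a power of $2$), computes $X=U\cdot V$ using the arithmetic of Strassen's recursive matrix multiplication algorithm, and has $O(n^w\log\log n)$ work, $O(\log n)$ span, and $O(n^w)$ space.
   Context: Binary-forking model: a computation starts with a single thread; any thread may fork (spawn) a concurrent asynchronous child thread, recursively, and threads are synchronized by join operations; the computation is a series-parallel DAG of instructions. No locks and no atomic instructions (such as test-and-set) are used. Work is the total number of instructions (nodes of the DAG); span is the length of the longest path in the DAG (time with unboundedly many processors); space is the amount of memory allocated (from the heap). Strassen's algorithm multiplies $n\times n$ matrices by splitting each into $2\times 2$ blocks of size $n/2$, forming 7 block products of linear combinations of input blocks recursively, and combining them linearly into the output blocks; sequentially it performs $O(n^{\log_2 7})$ arithmetic operations. *)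

(* Defs.v *)
(* MathComp world; MathComp-Analysis is used only for the real numbers. *)
From HB Require Import structures.
From mathcomp Require Import all_boot all_order all_algebra.
From mathcomp Require Import reals exp.

Set Implicit Arguments.
Unset Strict Implicit.
Unset Printing Implicit Defensive.

Import Order.TTheory GRing.Theory Num.Theory.
Local Open Scope ring_scope.

(** * The binary-forking model

    A program is a finite list of procedures over thread-private registers and
    a shared block-structured memory.  It mentions neither the matrix dimension
    nor the ring of scalars, so one program is a uniform algorithm. *)

(* [Plus], [Minus] act on words and on scalars ([Minus] on words is truncated), and
   [Plus] also moves a pointer inside its block.  [Times] acts on scalars only:
   without word multiplication, an instruction at most doubles the largest word
   it depends on, so all the words of a computation of span O(log n) started
   from n have O(log n) bits, although words are not bounded a priori. *)
Variant binop := Plus | Minus | Times | Leq.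
Variant unop := Copy | Half | Odd.

Variant instr :=
  | Const (x : nat) (c : nat)
  | Zero (x : nat)
  | Un (o : unop) (x y : nat)
  | Bin (o : binop) (x y z : nat)
  | Read (x y : nat)
  | Write (x y : nat)
  | Alloc (x y : nat).

(* [Fork c1 c2]: the current thread spawns a child running [c1] on a copy of its
   registers, runs [c2] itself, and then joins the child.
   [Call y f xs]: runs procedure [f] in a new frame whose first registers are the
   arguments [xs]; its register 0 is then returned in [y]. *)
Inductive com :=
  | Do (i : instr)
  | Seq (c1 c2 : com)
  | If (x : nat) (c1 c2 : com)
  | Call (y f : nat) (xs : seq nat)
  | Fork (c1 c2 : com).

Definition program := seq com.

Section Model.
Variable R : nzRingType.

(* Pointers (block, offset) are opaque: no instruction compares them or turns
   them into words, so nothing can depend on how blocks are named. *)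
Variant value := Undef | Word (n : nat) | Ptr (b o : nat) | Scal (a : R).

Definition regs := nat -> value.
Definition memory := seq (seq value).
Definition addr := (nat * nat)%type.

Definition upd (r : regs) (x : nat) (v : value) : regs :=
  fun y => if y == x then v else r y.

Definition frame (vs : seq value) : regs := nth Undef vs.

(* Reads and writes refer to the shared memory, not to the registers. *)
Variant event :=
  | ENone
  | ERead (p : addr)
  | EWrite (p : addr)
  | EAlloc (s : nat)
  | EProd (a b : R).

(** ** Series-parallel DAGs of instructions

    [DPar d1 d2] consists of a fork node, the two parallel sub-DAGs, and a join
    node. *)
Inductive dag :=
  | DNode (e : event)
  | DSer (d1 d2 : dag)
  | DPar (d1 d2 : dag).

Fixpoint dag_work (d : dag) : nat :=
  match d with
  | DNode _ => 1%N
  | DSer d1 d2 => (dag_work d1 + dag_work d2)%N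
  | DPar d1 d2 => (dag_work d1 + dag_work d2)%N.+2
  end.

Fixpoint dag_span (d : dag) : nat :=
  match d with
  | DNode _ => 1%N
  | DSer d1 d2 => (dag_span d1 + dag_span d2)%N
  | DPar d1 d2 => (maxn (dag_span d1) (dag_span d2)).+2
  end.

Fixpoint events (d : dag) : seq event :=
  match d with
  | DNode e => [:: e]
  | DSer d1 d2 | DPar d1 d2 => events d1 ++ events d2
  end.

(* Memory is never freed, so the peak usage under any schedule is the total
   number of cells allocated. *)
Definition dag_space (d : dag) : nat :=
  sumn [seq if e is EAlloc s then s else 0%N | e <- events d].

Definition reads (d : dag) : seq addr :=
  pmap (fun e => if e is ERead p then Some p else None) (events d).

Definition writes (d : dag) : seq addr :=
  pmap (fun e => if e is EWrite p then Some p else None) (events d).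

Definition products (d : dag) : seq (R * R) :=
  pmap (fun e => if e is EProd a b then Some (a, b) else None) (events d).

(* Neither sub-computation writes a cell that the other one accesses. *)
Definition independent (d1 d2 : dag) : bool :=
  ~~ has (mem (reads d1 ++ writes d1)) (writes d2) &&
  ~~ has (mem (writes d1)) (reads d2).

Fixpoint race_free (d : dag) : bool :=
  match d with
  | DNode _ => true
  | DSer d1 d2 => race_free d1 && race_free d2
  | DPar d1 d2 => [&& race_free d1, race_free d2 & independent d1 d2]
  end.

(** ** Semantics *)

Definition eval_un (o : unop) (v : value) : option value :=
  match o, v with
  | Copy, _ => Some v
  | Half, Word a => Some (Word a./2)
  | Odd, Word a => Some (Word (odd a))
  | _, _ => None
  end.

Definition eval_bin (o : binop) (u v : value) : option value :=
  match o, u, v with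
  | Plus, Word a, Word b => Some (Word (a + b)%N)
  | Plus, Ptr p i, Word a => Some (Ptr p (i + a)%N)
  | Plus, Scal a, Scal b => Some (Scal (a + b))
  | Minus, Word a, Word b => Some (Word (a - b)%N)
  | Minus, Scal a, Scal b => Some (Scal (a - b))
  | Times, Scal a, Scal b => Some (Scal (a * b))
  | Leq, Word a, Word b => Some (Word (a <= b)%N)
  | _, _, _ => None
  end.

Definition ev_bin (o : binop) (u v : value) : event :=
  match o, u, v with
  | Times, Scal a, Scal b => EProd a b
  | _, _, _ => ENone
  end.

(* An ill-typed operation or an access out of bounds is stuck. *)
Definition step (i : instr) (r : regs) (m : memory) :
    option (regs * memory * event) :=
  match i with
  | Const x c => Some (upd r x (Word c), m, ENone)
  | Zero x => Some (upd r x (Scal 0), m, ENone)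
  | Un o x y =>
      if eval_un o (r y) is Some v then Some (upd r x v, m, ENone) else None
  | Bin o x y z =>
      if eval_bin o (r y) (r z) is Some v
      then Some (upd r x v, m, ev_bin o (r y) (r z)) else None
  | Read x y =>
      if r y is Ptr b i then
        if (i < size (nth [::] m b))%N
        then Some (upd r x (nth Undef (nth [::] m b) i), m, ERead (b, i))
        else None
      else None
  | Write x y =>
      if r x is Ptr b i then
        if (i < size (nth [::] m b))%N
        then Some (r, set_nth [::] m b (set_nth Undef (nth [::] m b) i (r y)),
                   EWrite (b, i))
        else None
      else None
  | Alloc x y =>
      if r y is Word s
      then Some (upd r x (Ptr (size m) 0), rcons m (nseq s Undef), EAlloc s)
      else None
  end.

(* [exec P c r m r' m' d]: [c] terminates from registers [r] and memory [m] with
   [r'] and [m'], and [d] is the DAG of the executed instructions.  The rule for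
   [Fork] runs the child first; when [d] is race free, every other schedule
   computes the same result with the same DAG, up to the names of blocks. *)
Inductive exec (P : program) :
    com -> regs -> memory -> regs -> memory -> dag -> Prop :=
  | XDo i r m r' m' e of step i r m = Some (r', m', e) :
      exec P (Do i) r m r' m' (DNode e)
  | XSeq c1 c2 r m r1 m1 d1 r2 m2 d2 of
      exec P c1 r m r1 m1 d1 & exec P c2 r1 m1 r2 m2 d2 :
      exec P (Seq c1 c2) r m r2 m2 (DSer d1 d2)
  | XIf x c1 c2 r m n r' m' d of
      r x = Word n & exec P (if n != 0%N then c1 else c2) r m r' m' d :
      exec P (If x c1 c2) r m r' m' (DSer (DNode ENone) d)
  | XCall y f xs body r m r' m' d of
      onth P f = Some body &
      exec P body (frame [seq r x | x <- xs]) m r' m' d :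
      exec P (Call y f xs) r m (upd r y (r' 0%N)) m'
        (DSer (DNode ENone) (DSer d (DNode ENone)))
  | XFork c1 c2 r m r1 m1 d1 r2 m2 d2 of
      exec P c1 r m r1 m1 d1 & exec P c2 r m1 r2 m2 d2 :
      exec P (Fork c1 c2) r m r2 m2 (DPar d1 d2).

Lemma exec_deterministic P c r m r1 m1 d1 r2 m2 d2 :
  exec P c r m r1 m1 d1 -> exec P c r m r2 m2 d2 ->
  [/\ r1 = r2, m1 = m2 & d1 = d2].
Proof.
move=> E; elim: E r2 m2 d2 => {c r m r1 m1 d1}.
- move=> i r m r' m' e H r2 m2 d2 E; inversion E as [? ? ? ? ? ? H'| | | |].
  by subst; move: H'; rewrite H => -[-> -> ->].
- move=> c1 c2 r m r1 m1 d1 r2 m2 d2 _ IH1 _ IH2 r3 m3 d3 E.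
  inversion E as [|? ? ? ? ? ? ? ? ? ? E1 E2| | |]; subst.
  by have [? ? ?] := IH1 _ _ _ E1; subst; have [-> -> ->] := IH2 _ _ _ E2.
- move=> x c1 c2 r m n r' m' d Hx _ IH r2 m2 d2 E.
  inversion E as [| |? ? ? ? ? ? ? ? ? Hx' E1| |]; subst.
  by move: Hx' E1; rewrite Hx => -[<-] /IH[-> -> ->].
- move=> y f xs body r m r' m' d Hf _ IH r2 m2 d2 E.
  inversion E as [| | |? ? ? ? ? ? ? ? ? Hf' E1|]; subst.
  by move: Hf' E1; rewrite Hf => -[<-] /IH[-> -> ->].
move=> c1 c2 r m r1 m1 d1 r2 m2 d2 _ IH1 _ IH2 r3 m3 d3 E.
inversion E as [| | | |? ? ? ? ? ? ? ? ? ? E1 E2]; subst.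
by have [? ? ?] := IH1 _ _ _ E1; subst; have [-> -> ->] := IH2 _ _ _ E2.
Qed.

Definition row_major (n : nat) (A : 'M[R]_n) : seq value :=
  [seq Scal (A i j) | i <- enum 'I_n, j <- enum 'I_n].

(* Procedure 0 is called with the dimension and pointers to the two inputs
   (blocks 0 and 1, in row-major order) and to the output area (block 2), whose
   initial contents [X0] are arbitrary. *)
Definition run (P : program) (n : nat) (U V : 'M[R]_n) (X0 : seq value)
    (m : memory) (d : dag) : Prop :=
  exists r : regs,
    exec P (Call 0 0 [:: 0; 1; 2; 3]%N)
      (frame [:: Word n; Ptr 0 0; Ptr 1 0; Ptr 2 0])
      [:: row_major U; row_major V; X0] r m d.

(** * Strassen's algorithm *)

Lemma pow2S k : (2 ^ k.+1 = 2 ^ k + 2 ^ k)%N.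
Proof. by rewrite expnS mul2n addnn. Qed.

Definition split2 k (A : 'M[R]_(2 ^ k.+1)) : 'M[R]_(2 ^ k + 2 ^ k) :=
  castmx (pow2S k, pow2S k) A.

Definition join2 k (A : 'M[R]_(2 ^ k + 2 ^ k)) : 'M[R]_(2 ^ k.+1) :=
  castmx (esym (pow2S k), esym (pow2S k)) A.

(* The result together with the list of all the scalar products performed, as
   ordered pairs of factors. *)
Fixpoint strassen (k : nat) :
    'M[R]_(2 ^ k) -> 'M[R]_(2 ^ k) -> 'M[R]_(2 ^ k) * seq (R * R) :=
  match k with
  | 0 => fun U V : 'M[R]_1 => ((U 0 0 * V 0 0)%:M, [:: (U 0 0, V 0 0)])
  | k'.+1 => fun U V =>
    let: (A, B) := (split2 U, split2 V) in
    let: (A11, A12) := (ulsubmx A, ursubmx A) in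
    let: (A21, A22) := (dlsubmx A, drsubmx A) in
    let: (B11, B12) := (ulsubmx B, ursubmx B) in
    let: (B21, B22) := (dlsubmx B, drsubmx B) in
    let: (M1, s1) := strassen (A11 + A22) (B11 + B22) in
    let: (M2, s2) := strassen (A21 + A22) B11 in
    let: (M3, s3) := strassen A11 (B12 - B22) in
    let: (M4, s4) := strassen A22 (B21 - B11) in
    let: (M5, s5) := strassen (A11 + A12) B22 in
    let: (M6, s6) := strassen (A21 - A11) (B11 + B12) in
    let: (M7, s7) := strassen (A12 - A22) (B21 + B22) in
    (join2 (block_mx (M1 + M4 - M5 + M7) (M3 + M5)
                     (M2 + M4) (M1 - M2 + M3 + M6)),
     s1 ++ s2 ++ s3 ++ s4 ++ s5 ++ s6 ++ s7)
  end.

Definition strassen_products (k : nat) (U V : 'M[R]_(2 ^ k)) : seq (R * R) :=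
  (strassen U V).2.

Lemma strassen_correct k (U V : 'M[R]_(2 ^ k)) : (strassen U V).1 = U *m V.
Proof.
elim: k U V => [|k IH] U V.
  by apply/matrixP=> i j; rewrite !mxE big_ord1 !ord1 eqxx mulr1n.
rewrite /=.
set A11 := ulsubmx (split2 U); set A12 := ursubmx (split2 U).
set A21 := dlsubmx (split2 U); set A22 := drsubmx (split2 U).
set B11 := ulsubmx (split2 V); set B12 := ursubmx (split2 V).
set B21 := dlsubmx (split2 V); set B22 := drsubmx (split2 V).
have H1 := IH (A11 + A22) (B11 + B22); have H2 := IH (A21 + A22) B11.
have H3 := IH A11 (B12 - B22); have H4 := IH A22 (B21 - B11).
have H5 := IH (A11 + A12) B22; have H6 := IH (A21 - A11) (B11 + B12).
have H7 := IH (A12 - A22) (B21 + B22).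
move: H1 H2 H3 H4 H5 H6 H7.
do 7!case: (strassen _ _) => ? ? /=.
do 7!move->.
have EU : U = join2 (block_mx A11 A12 A21 A22).
  by rewrite /join2 submxK /split2 castmxK.
have EV : V = join2 (block_mx B11 B12 B21 B22).
  by rewrite /join2 submxK /split2 castmxK.
have join2M (A B : 'M[R]_(2 ^ k + 2 ^ k)) : join2 A *m join2 B = join2 (A *m B).
  rewrite /join2; move: (esym (pow2S k)) => e.
  by case: _ / e; rewrite !castmx_id.
clearbody A11 A12 A21 A22 B11 B12 B21 B22.
rewrite [in RHS]EU [in RHS]EV join2M mulmx_block.
congr (join2 (block_mx _ _ _ _));
  rewrite !(mulmxDl, mulmxDr, mulmxBl, mulmxBr, mulNmx, mulmxN, opprD, opprK) !addrA.
- by rewrite [LHS](ACl (1*9*2*7*3*6*4*12*5*11*10*8)%AC) /= !addrK.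
- by rewrite subrK.
- by rewrite [LHS](ACl (1*3*2*4)%AC) /= addrK.
by rewrite [LHS](ACl (10*4*1*11*2*8*3*6*9*5*7*12)%AC) /= !addrK.
Qed.

End Model.

Arguments Undef {R}.
Arguments Word {R} n.
Arguments Ptr {R} b o.

Definition log2 (K : realType) (x : K) : K := ln x / ln 2%:R.

(* The exponent w of Strassen's algorithm. *)
Definition omega (K : realType) : K := log2 7%:R.

(* Main.v *)
(* Store a matrix recursively, quadrant after quadrant.  Strassen's algorithm is
   then three linear maps applied to vectors of length 4^a: two 7 x 4 matrices A, B
   with entries 0, 1, -1 prepare the factors of the seven products, and a 4 x 7
   matrix C combines the results.  Unfolding t levels of the recursion at once
   replaces A, B, C by their t-th tensor powers.  Each entry of the image of such a
   power is a signed sum over at most 7^t terms, computed by a tree of forks of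
   depth t, and all entries are computed in parallel.

   With t = ceil(a / 8) and b = a - t, such a stage has span O(a) and, even when
   every sum is counted as 8^t terms, work and space O(64^t 4^b).  The remaining
   7^t subproblems have dimension 2^b.  The spans S(a) = S(b) + O(a) add up
   geometrically to O(a).  For the total W(a) = 7^t W(b) + O(64^t 4^b) of work and
   space, the bound W(a) <= C 7^a - E 6^a is preserved by the recursion; so both
   are O(7^a), which is stronger than what the theorem asks of the work.

   Race freedom is local: every procedure writes only to an interval of one block
   and to blocks that it has allocated, and reads no old block that it writes to. *)
Require Import Defs.
From mathcomp Require Import all_boot all_order all_algebra.
From mathcomp Require Import reals exp.
From mathcomp Require Import zify.

Set Implicit Arguments.
Unset Strict Implicit.
Unset Printing Implicit Defensive.

Import Order.TTheory GRing.Theory Num.Theory.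
Local Open Scope ring_scope.

(** * A program logic *)

Section Logic.
Variables (R : nzRingType) (P : program).
Local Open Scope nat_scope.

Implicit Types (r : regs R) (m : memory R) (d : dag R) (b : nat).
Implicit Types (rb : seq nat) (wb : nat).

(** Run level by level, Strassen's recursion needs a tree of forks over the matrix entries at each
    of its log n levels, hence a span of order (log n)^2. Unfolding a constant fraction of the
    remaining levels in one stage makes the spans of the stages decrease geometrically. The price is
    the loss of sharing: each entry of a tensor power is summed from scratch, without reuse of the
    partial sums of other entries, and this is what keeps the fraction small. An eighth also suits
    the instruction set: words can be halved but neither divided nor multiplied, so [t] is obtained
    by three halvings and the digits are taken in base 8.

    The semantics of [Fork] is sequential and names blocks by order of allocation. The proof
    exploits this: the memory size between the two sides of a fork separates the blocks that each
    side allocates, so race freedom reduces to comparing intervals of a single output block. *)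

Definition blk m b : seq (value R) := nth [::] m b.
Definition cell m b i : value R := nth Undef (blk m b) i.
Definition put m b i v : memory R :=
  set_nth [::] m b (set_nth Undef (blk m b) i v).

Lemma size_put m b i v : b < size m -> size (put m b i v) = size m.
Proof. by move=> bm; rewrite size_set_nth; apply/maxn_idPr. Qed.

Lemma blk_put_neq m b i v b' : b' != b -> blk (put m b i v) b' = blk m b'.
Proof. by move=> /negPf nb; rewrite /blk nth_set_nth /= nb. Qed.

Lemma size_blk_put m b i v b' :
  i < size (blk m b) -> size (blk (put m b i v) b') = size (blk m b').
Proof.
move=> im; have [->|/blk_put_neq->//] := eqVneq b' b.
by rewrite /put {1}/blk nth_set_nth /= eqxx size_set_nth; apply/maxn_idPr.
Qed.

Lemma cell_put m b i v b' j :
  cell (put m b i v) b' j = if (b' == b) && (j == i) then v else cell m b' j.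
Proof.
rewrite /cell; have [->|/blk_put_neq->//] := eqVneq b' b.
by rewrite /put /blk nth_set_nth /= eqxx nth_set_nth.
Qed.

Lemma blk_oob m b i : i < size (blk m b) -> b < size m.
Proof.
rewrite ltnNge => ib; rewrite ltnNge; apply: contra ib => /(nth_default _).
by rewrite /blk => ->.
Qed.

Lemma blk_rcons m s b : b < size m -> blk (rcons m s) b = blk m b.
Proof. by rewrite /blk nth_rcons => ->. Qed.

Lemma blk_rcons_last m s : blk (rcons m s) (size m) = s.
Proof. by rewrite /blk nth_rcons ltnn eqxx. Qed.

(** Bounding every accessed block by the final memory size is what separates the two sides of a
    fork: the blocks allocated by the child lie below the size at which the other side starts
    allocating. *)
Lemma exec_frame c r m r' m' d : exec P c r m r' m' d ->
  [/\ size m <= size m',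
      forall b, b < size m -> size (blk m' b) = size (blk m b),
      all (fun p => p.1 < size m') (reads d),
      all (fun p => p.1 < size m') (writes d) &
      forall b i, b < size m -> (b, i) \notin writes d ->
        cell m' b i = cell m b i].
Proof.
have all_widen (n1 n2 : nat) (s : seq addr) : n1 <= n2 ->
    all (fun p => p.1 < n1) s -> all (fun p => p.1 < n2) s.
  by move=> le_n; apply: sub_all => p /leq_trans; apply.
elim=> {c r m r' m' d} /=.
- move=> i r m r' m' e.
  case: i => /= [x c|x|o x y|o x y z|x y|x y|x y].
  + by case=> _ <- <-.
  + by case=> _ <- <-.
  + by case: eval_un => // v [_ <- <-].
  + case: eval_bin => // v [_ <- <-]; rewrite /reads /writes /=.
    by case: o => //; case: (r y) => // ?; case: (r z) => // ?; split.
  + case: (r y) => // b i; case: ifP => // lt_i [_ <- <-].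
    by split=> //=; rewrite (blk_oob lt_i).
  + case: (r x) => // b i; case: ifP => // lt_i [_ <- <-].
    rewrite -/(blk m b) -/(put m b i (r y)).
    have lt_b := blk_oob lt_i; rewrite size_put //.
    split=> //= [b' _|//|b' j _]; first exact: size_blk_put.
      by rewrite lt_b.
    by rewrite inE cell_put xpair_eqE => /negPf->.
  + case: (r y) => // s [_ <- <-]; rewrite size_rcons.
    split=> // [b lt_b|b i lt_b _]; rewrite /cell /blk nth_rcons lt_b //.
- move=> c1 c2 r m r1 m1 d1 r2 m2 d2 _ [s1 b1 R1 W1 F1] _ [s2 b2 R2 W2 F2].
  rewrite /reads /writes /= !pmap_cat !all_cat R2 W2 !(all_widen _ _ _ s2) //.
  split=> // [|b lt_b|b i lt_b]; first exact: leq_trans s2.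
    by rewrite b2 ?b1 //; apply: leq_trans s1.
  rewrite mem_cat negb_or => /andP[n1 n2].
  by rewrite F2 ?F1 //; apply: leq_trans s1.
- by move=> *.
- move=> y f xs body r m r' m' d _ _ [s1 b1 R1 W1 F1].
  by rewrite /reads /writes /= !pmap_cat /= !cats0.
- move=> c1 c2 r m r1 m1 d1 r2 m2 d2 _ [s1 b1 R1 W1 F1] _ [s2 b2 R2 W2 F2].
  rewrite /reads /writes /= !pmap_cat !all_cat R2 W2 !(all_widen _ _ _ s2) //.
  split=> // [|b lt_b|b i lt_b]; first exact: leq_trans s2.
    by rewrite b2 ?b1 //; apply: leq_trans s1.
  rewrite mem_cat negb_or => /andP[n1 n2].
  by rewrite F2 ?F1 //; apply: leq_trans s1.
Qed.

Definition within (lo len i : nat) : bool := (lo <= i) && (i < lo + len).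

Definition confined (N : nat) (rb : seq nat) (wb lo len : nat) d : bool :=
  all (fun p => (p.1 \in rb) || (N <= p.1)) (reads d) &&
  all (fun p => (p.1 == wb) && within lo len p.2 || (N <= p.1)) (writes d).

(** Work and space obey the same recurrence, so only their sum is bounded; each is recovered from it
    at the end. *)
Definition cost d : nat := dag_work d + dag_space d.

(* The footprint of a triple consists of the blocks [rb], which may be read, the
   cells [lo, lo + len) of the block [wb], which may be written, and the blocks
   from [N] on, which were allocated after the procedure was entered. *)
Definition triple N rb wb lo len c r m k s (ps : seq (R * R))
    (Q : regs R -> memory R -> Prop) : Prop :=
  exists r' m' d,
    [/\ exec P c r m r' m' d, race_free d, confined N rb wb lo len d &
        [/\ cost d <= k, dag_span d <= s, products d = ps & Q r' m']].

(** The contents of [wb] are left free because the siblings in a parallel loop write there; its size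
    is fixed, so that bounds checks remain valid. *)
Definition keeps wb m m' : Prop :=
  [/\ size m <= size m', size (blk m' wb) = size (blk m wb) &
      forall b, b < size m -> b != wb -> blk m' b = blk m b].

Lemma keeps_trans wb m1 m2 m3 :
  keeps wb m1 m2 -> keeps wb m2 m3 -> keeps wb m1 m3.
Proof.
move=> [s1 e1 f1] [s2 e2 f2]; split; first exact: leq_trans s2.
  by rewrite e2.
by move=> b lt_b nb; rewrite f2 ?f1 //; apply: leq_trans s1.
Qed.

Definition evolves wb lo len m m' : Prop :=
  keeps wb m m' /\
  forall i, ~~ within lo len i -> cell m' wb i = cell m wb i.

(** The frame property follows from the footprint of the DAG, so specifications never list what they
    preserve. The threshold is the initial memory size, so no old block passes for a fresh one. *)
Lemma exec_evolves rb wb lo len c r m r' m' d : wb < size m ->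
  exec P c r m r' m' d -> confined (size m) rb wb lo len d ->
  evolves wb lo len m m'.
Proof.
move=> lt_w X /andP[_ /allP W]; have [s1 b1 _ _ F1] := exec_frame X.
have nW b i : b < size m -> ~~ ((b == wb) && within lo len i) ->
    (b, i) \notin writes d.
  move=> lt_b nb; apply/negP => /W /=; rewrite (negPf nb) /=.
  by rewrite leqNgt lt_b.
split; first split=> // [|b lt_b nb]; first exact: b1.
  apply: (@eq_from_nth _ Undef) => [|i _]; first exact: b1.
  by apply: F1 => //; apply: nW => //; rewrite (negPf nb).
by move=> i ni; apply: F1 => //; apply: nW; rewrite ?eqxx.
Qed.

Lemma triple_le N rb wb lo len c r m k s ps Q k' s' : k <= k' -> s <= s' ->
  triple N rb wb lo len c r m k s ps Q -> triple N rb wb lo len c r m k' s' ps Q.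
Proof.
move=> lek les [r' [m' [d [X rf cf [K S p q]]]]]; exists r', m', d.
by split=> //; split=> //; [apply: leq_trans lek|apply: leq_trans les].
Qed.

Lemma triple_conv N rb wb lo len c r m k s ps Q k' s' ps' :
  k <= k' -> s <= s' -> ps = ps' ->
  triple N rb wb lo len c r m k s ps Q -> triple N rb wb lo len c r m k' s' ps' Q.
Proof. by move=> lek les <-; apply: triple_le. Qed.

Lemma cost_ser d1 d2 : cost (DSer d1 d2) = cost d1 + cost d2.
Proof. by rewrite /cost /dag_space /= map_cat sumn_cat addnACA. Qed.

Lemma cost_par d1 d2 : cost (DPar d1 d2) = (cost d1 + cost d2).+2.
Proof. by rewrite /cost /dag_space /= map_cat sumn_cat !addSn addnACA. Qed.

Lemma confined_ser N rb wb lo len d1 d2 :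
  confined N rb wb lo len (DSer d1 d2) =
  confined N rb wb lo len d1 && confined N rb wb lo len d2.
Proof. by rewrite /confined /reads /writes /= !pmap_cat !all_cat andbACA. Qed.

Lemma confined_par N rb wb lo len d1 d2 :
  confined N rb wb lo len (DPar d1 d2) =
  confined N rb wb lo len d1 && confined N rb wb lo len d2.
Proof. exact: confined_ser. Qed.

Lemma triple_seq N rb wb lo len c1 c2 r m k1 s1 ps1 Q1 k2 s2 ps2 Q :
  triple N rb wb lo len c1 r m k1 s1 ps1 Q1 ->
  (forall r1 m1, Q1 r1 m1 -> triple N rb wb lo len c2 r1 m1 k2 s2 ps2 Q) ->
  triple N rb wb lo len (Defs.Seq c1 c2) r m (k1 + k2) (s1 + s2) (ps1 ++ ps2) Q.
Proof.
move=> [r1 [m1 [d1 [X1 rf1 cf1 [K1 S1 p1 q1]]]]] /(_ _ _ q1).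
move=> [r2 [m2 [d2 [X2 rf2 cf2 [K2 S2 p2 q2]]]]].
exists r2, m2, (DSer d1 d2); split; first exact: XSeq X1 X2.
- by rewrite /= rf1 rf2.
- by rewrite confined_ser cf1 cf2.
split=> //; first by rewrite cost_ser leq_add.
  by rewrite /= leq_add.
by rewrite /products /= pmap_cat -p1 -p2.
Qed.

(** Instructions without an event, so that straight-line code can be run by computation. [Times] is
    excluded, since it records a product in the DAG. *)
Definition pure_step (i : instr) r : option (regs R) :=
  match i with
  | Const x c => Some (upd r x (Word c))
  | Zero x => Some (upd r x (Scal 0%R))
  | Un o x y => if eval_un o (r y) is Some v then Some (upd r x v) else None
  | Bin Times _ _ _ => None
  | Bin o x y z =>
      if eval_bin o (r y) (r z) is Some v then Some (upd r x v) else None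
  | _ => None
  end.

Fixpoint pure_run (l : seq instr) r : option (regs R) :=
  if l is i :: l' then
    if pure_step i r is Some r1 then pure_run l' r1 else None
  else Some r.

Fixpoint prefix_com (l : seq instr) (c : com) : com :=
  if l is i :: l' then Defs.Seq (Do i) (prefix_com l' c) else c.

Lemma triple_do N rb wb lo len i r m r1 m1 e (Q : regs R -> memory R -> Prop) :
  step i r m = Some (r1, m1, e) -> confined N rb wb lo len (DNode e) ->
  Q r1 m1 ->
  triple N rb wb lo len (Do i) r m (1 + (if e is EAlloc s then s else 0)) 1
    (products (DNode e)) Q.
Proof.
move=> st cf q; exists r1, m1, (DNode e).
split=> //; first exact: XDo.
by split=> //; rewrite /cost /dag_space /= addn0.
Qed.

Lemma triple_do_pure N rb wb lo len i r m r1 (Q : regs R -> memory R -> Prop) :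
  step i r m = Some (r1, m, ENone R) -> Q r1 m ->
  triple N rb wb lo len (Do i) r m 1 1 [::] Q.
Proof. by move=> st q; exact: (triple_do st). Qed.

Lemma triple_pure N rb wb lo len l c r r1 m k s ps Q :
  pure_run l r = Some r1 ->
  triple N rb wb lo len c r1 m k s ps Q ->
  triple N rb wb lo len (prefix_com l c) r m (size l + k) (size l + s) ps Q.
Proof.
elim: l r => [|i l IH] r /=; first by case=> ->.
case E: pure_step => [r2|//] /IH{}IH /IH{}IH.
rewrite 2!addSn -2!add1n -[ps]cat0s.
apply: (@triple_seq _ _ _ _ _ _ _ _ _ 1 1 [::] (fun r' m' => r' = r2 /\ m' = m));
  last by move=> ? ? [-> ->].
have st : step i r m = Some (r2, m, ENone R).
  move: E; case: i => //= [x c0|x|o x y|o x y z]; try by case=> <-.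
    by case: eval_un => // v [<-].
  by case: o => //; case: eval_bin => // v [<-].
exact: (triple_do st).
Qed.

Lemma triple_read N rb wb lo len x y c r m k s ps Q b i v :
  r y = Ptr b i -> (b \in rb) || (N <= b) ->
  cell m b i = v -> v <> Undef ->
  triple N rb wb lo len c (upd r x v) m k s ps Q ->
  triple N rb wb lo len (Defs.Seq (Do (Read x y)) c) r m (1 + k) (1 + s) ps Q.
Proof.
move=> ry ok cv nv H; rewrite -[ps]cat0s.
apply: (@triple_seq _ _ _ _ _ _ _ _ _ 1 1 [::]
  (fun r' m' => r' = upd r x v /\ m' = m)); last by move=> ? ? [-> ->].
(* Out of bounds [cell] returns [Undef], so a defined value certifies the index. *)
have lt_i : i < size (blk m b).
  by rewrite ltnNge; apply/negP=> le_i; apply: nv; rewrite -cv /cell nth_default.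
apply: (@triple_do _ _ _ _ _ _ _ _ _ _ (ERead R (b, i))) => //.
  by rewrite /= ry lt_i -cv.
by rewrite /confined /= ok.
Qed.

Lemma triple_write N rb wb lo len x y r m b i
    (Q : regs R -> memory R -> Prop) :
  r x = Ptr b i -> (b == wb) && within lo len i || (N <= b) ->
  i < size (blk m b) -> Q r (put m b i (r y)) ->
  triple N rb wb lo len (Do (Write x y)) r m 1 1 [::] Q.
Proof.
move=> rx ok lt_i q.
apply: (@triple_do _ _ _ _ _ _ _ _ _ _ (EWrite R (b, i))) q.
  by rewrite /= rx lt_i.
by rewrite /confined /= ok.
Qed.

Lemma triple_alloc N rb wb lo len x y c r m k s ps Q n :
  r y = Word n ->
  triple N rb wb lo len c (upd r x (Ptr (size m) 0)) (rcons m (nseq n Undef))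
    k s ps Q ->
  triple N rb wb lo len (Defs.Seq (Do (Alloc x y)) c) r m (1 + n + k) (1 + s) ps Q.
Proof.
move=> ry H; rewrite -[ps]cat0s.
apply: (@triple_seq _ _ _ _ _ _ _ _ _ (1 + n) 1 [::] (fun r' m' =>
  r' = upd r x (Ptr (size m) 0) /\ m' = rcons m (nseq n Undef)));
  last by move=> ? ? [-> ->].
by apply: (@triple_do _ _ _ _ _ _ _ _ _ _ (EAlloc R n)); rewrite //= ry.
Qed.

Lemma triple_times N rb wb lo len x y z c r m k s ps Q (a1 a2 : R) :
  r y = Scal a1 -> r z = Scal a2 ->
  triple N rb wb lo len c (upd r x (Scal (a1 * a2)%R)) m k s ps Q ->
  triple N rb wb lo len (Defs.Seq (Do (Bin Times x y z)) c) r m (1 + k) (1 + s)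
    ((a1, a2) :: ps) Q.
Proof.
move=> ry rz H; rewrite -cat1s.
apply: (@triple_seq _ _ _ _ _ _ _ _ _ 1 1 [:: (a1, a2)] (fun r' m' =>
  r' = upd r x (Scal (a1 * a2)%R) /\ m' = m)); last by move=> ? ? [-> ->].
by apply: (@triple_do _ _ _ _ _ _ _ _ _ _ (EProd a1 a2)); rewrite //= ry rz.
Qed.

Lemma triple_if N rb wb lo len x c1 c2 r m k s ps Q n :
  r x = Word n ->
  triple N rb wb lo len (if n != 0 then c1 else c2) r m k s ps Q ->
  triple N rb wb lo len (If x c1 c2) r m (1 + k) (1 + s) ps Q.
Proof.
move=> rx [r' [m' [d [X rf cf [K S p q]]]]].
exists r', m', (DSer (DNode (ENone R)) d); by split=> //; exact: XIf rx X.
Qed.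

Lemma triple_then N rb wb lo len x c1 c2 r m k s ps Q n :
  r x = Word n -> n != 0 ->
  triple N rb wb lo len c1 r m k s ps Q ->
  triple N rb wb lo len (If x c1 c2) r m (1 + k) (1 + s) ps Q.
Proof. by move=> rx nz T; apply: triple_if rx _; rewrite nz. Qed.

Lemma triple_else N rb wb lo len x c1 c2 r m k s ps Q :
  r x = Word 0 ->
  triple N rb wb lo len c2 r m k s ps Q ->
  triple N rb wb lo len (If x c1 c2) r m (1 + k) (1 + s) ps Q.
Proof. by move=> rx T; apply: triple_if rx _. Qed.

Definition proc f (args : seq (value R)) m rb wb lo len k s ps
    (Q : value R -> memory R -> Prop) : Prop :=
  exists2 body, onth P f = Some body &
    triple (size m) rb wb lo len body (frame args) m k s ps
      (fun r' m' => Q (r' 0) m').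

Definition sub_reads N (rb rb' : seq nat) :=
  all (fun b => (b \in rb) || (N <= b)) rb'.

(** The last case serves procedures that only return a word: they are specified with length 0 and an
    arbitrary block [wb']. *)
Definition sub_writes N wb lo len wb' lo' len' :=
  [|| N <= wb', [&& wb' == wb, lo <= lo' & lo' + len' <= lo + len] | len' == 0].

Lemma confined_sub N N' rb wb lo len rb' wb' lo' len' d : N <= N' ->
  sub_reads N rb rb' -> sub_writes N wb lo len wb' lo' len' ->
  confined N' rb' wb' lo' len' d -> confined N rb wb lo len d.
Proof.
move=> leN /allP subR subW /andP[/allP Rd /allP Wr]; apply/andP; split; apply/allP.
  move=> p /Rd /orP[/subR //|/(leq_trans leN)->]; exact: orbT.
move=> p /Wr /orP[/andP[/eqP-> in_i]|/(leq_trans leN)->]; last exact: orbT.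
case/or3P: subW => [->|/and3P[/eqP-> le1 le2]|/eqP e0].
- exact: orbT.
- rewrite eqxx /=; apply/orP; left; move: in_i; rewrite /within.
  by case/andP=> h1 h2; rewrite (leq_trans le1) // (leq_trans h2).
- by move: in_i; rewrite /within e0 addn0 => /andP[h1]; rewrite ltnNge h1.
Qed.

Lemma triple_sub N N' rb wb lo len rb' wb' lo' len' c r m k s ps Q : N <= N' ->
  sub_reads N rb rb' -> sub_writes N wb lo len wb' lo' len' ->
  triple N' rb' wb' lo' len' c r m k s ps Q ->
  triple N rb wb lo len c r m k s ps Q.
Proof.
move=> leN subR subW [r' [m' [d [X rf cf H]]]]; exists r', m', d.
by split=> //; apply: confined_sub cf.
Qed.

Lemma triple_evolves rb wb lo len c r m k s ps Q : wb < size m ->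
  triple (size m) rb wb lo len c r m k s ps Q ->
  triple (size m) rb wb lo len c r m k s ps
    (fun r' m' => Q r' m' /\ evolves wb lo len m m').
Proof.
move=> lt_w [r' [m' [d [X rf cf [K S p q]]]]]; exists r', m', d; split=> //.
by split=> //; split=> //; exact: (exec_evolves lt_w X cf).
Qed.

Lemma triple_post N rb wb lo len c r m k s ps
    (Q Q' : regs R -> memory R -> Prop) :
  triple N rb wb lo len c r m k s ps Q -> (forall r' m', Q r' m' -> Q' r' m') ->
  triple N rb wb lo len c r m k s ps Q'.
Proof.
move=> [r' [m' [d [X rf cf [K S p q]]]]] QQ; exists r', m', d.
by split=> //; split=> //; apply: QQ.
Qed.

Lemma triple_call N rb wb lo len y f xs args r m rb' wb' lo' len' k s ps Qf
    (Q : regs R -> memory R -> Prop) :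
  proc f args m rb' wb' lo' len' k s ps Qf -> [seq r x | x <- xs] = args ->
  N <= size m -> wb' < size m ->
  sub_reads N rb rb' -> sub_writes N wb lo len wb' lo' len' ->
  (forall v m', Qf v m' -> evolves wb' lo' len' m m' -> Q (upd r y v) m') ->
  triple N rb wb lo len (Call y f xs) r m (k + 2) (s + 2) ps Q.
Proof.
move=> [body Hf T] Ea leN lt_w subR subW QQ; subst args.
have [r' [m' [d [X rf cf [K S p [q ev]]]]]] := triple_evolves lt_w T.
exists (upd r y (r' 0)), m',
  (DSer (DNode (ENone R)) (DSer d (DNode (ENone R)))); split.
- exact: XCall Hf X.
- by rewrite /= rf.
- rewrite !confined_ser (confined_sub leN subR subW cf) /confined //=.
split; last exact: QQ.
- by rewrite !cost_ser; have -> : cost (DNode (ENone R)) = 1 by []; lia.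
- by rewrite /=; lia.
- by rewrite -p /products /= pmap_cat /= cats0.
Qed.

Lemma triple_call_seq N rb wb lo len y f xs args c r m rb' wb' lo' len'
    k1 s1 ps1 Qf k s ps Q :
  proc f args m rb' wb' lo' len' k1 s1 ps1 Qf -> [seq r x | x <- xs] = args ->
  N <= size m -> wb' < size m ->
  sub_reads N rb rb' -> sub_writes N wb lo len wb' lo' len' ->
  (forall v m', Qf v m' -> evolves wb' lo' len' m m' ->
     triple N rb wb lo len c (upd r y v) m' k s ps Q) ->
  triple N rb wb lo len (Defs.Seq (Call y f xs) c) r m
    (k1 + 2 + k) (s1 + 2 + s) (ps1 ++ ps) Q.
Proof.
move=> pf Ea leN lt_w subR subW T.
apply: (@triple_seq _ _ _ _ _ _ _ _ _ _ _ _ (fun r1 m1 =>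
  exists v, [/\ r1 = upd r y v, Qf v m1 & evolves wb' lo' len' m m1])).
  by apply: (triple_call pf Ea) => // v m' q ev; exists v.
by move=> r1 m1 [v [-> q ev]]; apply: T.
Qed.

(** * Parallel loops *)

(* There are [n.+1] copies of [c]; [adv] updates the registers from each copy to
   the next. *)
Fixpoint par n (adv : seq instr) (c : com) : com :=
  if n is n'.+1 then Fork c (prefix_com adv (par n' adv c)) else c.

(** The postcondition of one copy must survive the copies executed after it, so it may depend only
    on the slice of [wb] that this copy writes. *)
Definition stable wb lo len (Q : memory R -> Prop) : Prop :=
  forall m1 m2, (forall i, within lo len i -> cell m2 wb i = cell m1 wb i) ->
  Q m1 -> Q m2.

(** There are three kinds of cells: the old blocks in [rb] are written by neither side, the two
    slices of [wb] are disjoint, and the fresh blocks of the first side lie below [size m1] while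
    those of the second start there. *)
Lemma independent_forks wb lo1 len1 lo2 len2 rb m m1 d1 d2 :
  wb < size m -> wb \notin rb -> all (fun b => b < size m) rb ->
  size m <= size m1 -> lo1 + len1 <= lo2 ->
  confined (size m) rb wb lo1 len1 d1 ->
  all (fun p => p.1 < size m1) (reads d1) ->
  all (fun p => p.1 < size m1) (writes d1) ->
  confined (size m1) rb wb lo2 len2 d2 -> 
  independent d1 d2.
Proof.
move=> lt_w nw /allP ltR le_m le12 /andP[/allP r1 /allP w1] /allP R1 /allP W1.
move=> /andP[/allP r2 /allP w2].
have disj b : b \in rb -> b < size m1 by move/ltR/leq_trans; apply.
apply/andP; split; apply/hasPn => p.
  move=> /w2 h2; apply/negP; rewrite /= mem_cat => /orP[] h1.
    move: (r1 _ h1) (R1 _ h1); case/orP: h2 => [/andP[/eqP-> _]|]; last first.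
      by rewrite leqNgt => /negPf->.
    by rewrite (negPf nw) /= leqNgt lt_w.
  move: (w1 _ h1) (W1 _ h1); case/orP: h2 => [/andP[/eqP-> h2]|]; last first.
    by rewrite leqNgt => /negPf->.
  rewrite (leqNgt _ wb) lt_w eqxx orbF /= => /andP[_ lt2] _.
  by case/andP: h2 => /(leq_trans le12) /(leq_trans lt2); rewrite ltnn.
move=> /r2 h2; apply/negP => /= h1.
move: (w1 _ h1) (W1 _ h1); case/orP: h2 => [h2|]; last first.
  by rewrite leqNgt => /negPf->.
move: (h2) => /ltR lt2; rewrite (leqNgt _ p.1) lt2 orbF => /andP[/eqP e _].
by move: h2; rewrite e (negPf nw).
Qed.

(** The copies are peeled off one fork at a time. The span is linear in their number, which is
    harmless as no loop has more than seven copies. The body is specified for every memory that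
    [keeps] relates to [m], because a later copy starts from what the earlier ones left. *)
Lemma triple_par_rec n adv y f xs (rq : nat -> regs R) args m rb wb lo h k s ps
    (Q : nat -> memory R -> Prop) q0 :
  (forall q, q0 <= q < q0 + n -> pure_run adv (rq q) = Some (rq q.+1)) ->
  (forall q, q0 <= q <= q0 + n -> [seq rq q x | x <- xs] = args q) ->
  wb < size m -> wb \notin rb -> all (fun b => b < size m) rb ->
  (forall q, stable wb (lo + q * h) h (Q q)) ->
  (forall q m', q0 <= q <= q0 + n -> keeps wb m m' ->
     proc f (args q) m' rb wb (lo + q * h) h k s (ps q) (fun _ => Q q)) ->
  triple (size m) rb wb (lo + q0 * h) (n.+1 * h) (par n adv (Call y f xs)) (rq q0) m
    (n.+1 * (k + 4 + size adv)) (s + 2 + n * (2 + size adv))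
    (flatten [seq ps q | q <- iota q0 n.+1])
    (fun r' m' => (exists v, r' = upd (rq (q0 + n)) y v) /\
                  forall q, q0 <= q <= q0 + n -> Q q m').
Proof.
elim: n q0 m => [|n IH] q0 m Hadv Hargs lt_w nw ltR Hst Hf /=.
  have Hq: q0 <= q0 <= q0 + 0 by lia.
  have K0 : keeps wb m m by [].
  rewrite cats0 mul1n mul1n mul0n addn0.
  apply: (@triple_le _ _ _ _ _ _ _ _ (k + 2) (s + 2)); [lia|lia|].
  apply: (triple_call (Hf q0 m Hq K0) (Hargs _ Hq)) => //.
  - by rewrite /sub_reads; apply/allP => b ->.
  - by rewrite /sub_writes eqxx !leqnn /= orbT.
  move=> v m' q _; split; first by exists v; rewrite addn0.
  by move=> q'; rewrite addn0 => /anti_leq <-.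
have Hq: q0 <= q0 <= q0 + n.+1 by lia.
have K0 : keeps wb m m by [].
have T1 : triple (size m) rb wb (lo + q0 * h) h (Call y f xs) (rq q0) m
    (k + 2) (s + 2) (ps q0)
    (fun r' m' => Q q0 m' /\ evolves wb (lo + q0 * h) h m m').
  apply: (triple_call (Hf q0 m Hq K0) (Hargs _ Hq)) => //.
  - by rewrite /sub_reads; apply/allP => b ->.
  - by rewrite /sub_writes eqxx !leqnn /= orbT.
case: T1 => r1 [m1 [d1 [X1 rf1 cf1 [C1 S1 p1 [q1 [K1 ev1]]]]]].
have [le_m _ R1 W1 _] := exec_frame X1.
have lt_w1 : wb < size m1 by apply: leq_trans le_m.
have ltR1 : all (fun b => b < size m1) rb.
  by apply: sub_all ltR => b /leq_trans; apply.
have T2 : triple (size m1) rb wb (lo + q0.+1 * h) (n.+1 * h)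
    (prefix_com adv (par n adv (Call y f xs))) (rq q0) m1
    (size adv + n.+1 * (k + 4 + size adv))
    (size adv + (s + 2 + n * (2 + size adv)))
    (flatten [seq ps q | q <- iota q0.+1 n.+1])
    (fun r' m' => (exists v, r' = upd (rq (q0.+1 + n)) y v) /\
                  forall q, q0.+1 <= q <= q0.+1 + n -> Q q m').
  apply: triple_pure; first by apply: Hadv; lia.
  apply: IH => //.
  - by move=> q Hq'; apply: Hadv; lia.
  - by move=> q Hq'; apply: Hargs; lia.
  - move=> q m' Hq' K'; apply: Hf; first lia.
    exact: keeps_trans K1 K'.
case: (triple_evolves lt_w1 T2).
move=> r2 [m2 [d2 [X2 rf2 cf2 [C2 S2 p2 [[Hr2 q2] [K2 ev2]]]]]].
exists r2, m2, (DPar d1 d2); split.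
- exact: XFork X1 X2.
- apply/and3P; split=> //.
  apply: (independent_forks lt_w nw ltR le_m _ cf1 R1 W1 cf2); clear; lia.
- rewrite confined_par; apply/andP; split.
    apply: confined_sub cf1 => //; first by apply/allP => b ->.
    by rewrite /sub_writes eqxx /=; apply/or3P; apply: Or32; clear; lia.
  apply: confined_sub cf2 => //; first by apply/allP => b ->.
  by rewrite /sub_writes eqxx /=; apply/or3P; apply: Or32; clear; lia.
split.
- by rewrite cost_par; clear -C1 C2; lia.
- by rewrite /=; clear -S1 S2; lia.
- by rewrite /products /= pmap_cat; congr cat.
split; first by case: Hr2 => v ->; exists v; rewrite addSnnS.
move=> q Hq'; have [e|ne] := eqVneq q q0; last by apply: q2; clear -Hq' ne; lia.
(* The remaining copies write only from [lo + q0.+1 * h] on, beyond the slice of copy [q0]. *)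
rewrite e; apply: Hst q1 => i Hi; apply: ev2; move: Hi; rewrite /within.
by clear; lia.
Qed.

(** Made total, so that the registers seen by copy [q] can be written as an iterate. *)
Definition advance adv r : regs R :=
  if pure_run adv r is Some r' then r' else r.

Lemma triple_par n adv y f xs r args N rb wb lo len m rb' wb' lo' h k s ps
    (Q : nat -> memory R -> Prop) :
  (forall q, q < n -> isSome (pure_run adv (iter q (advance adv) r))) ->
  (forall q, q <= n -> [seq iter q (advance adv) r x | x <- xs] = args q) ->
  wb' < size m -> wb' \notin rb' -> all (fun b => b < size m) rb' -> N <= size m ->
  sub_reads N rb rb' -> sub_writes N wb lo len wb' lo' (n.+1 * h) ->
  (forall q, stable wb' (lo' + q * h) h (Q q)) ->
  (forall q m', q <= n -> keeps wb' m m' ->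
     proc f (args q) m' rb' wb' (lo' + q * h) h k s (ps q) (fun _ => Q q)) ->
  triple N rb wb lo len (par n adv (Call y f xs)) r m
    (n.+1 * (k + 4 + size adv)) (s + 2 + n * (2 + size adv))
    (flatten [seq ps q | q <- iota 0 n.+1])
    (fun r' m' => [/\ exists v, r' = upd (iter n (advance adv) r) y v,
                  forall q, q <= n -> Q q m' &
                  evolves wb' lo' (n.+1 * h) m m']).
Proof.
move=> Hadv Hargs lt_w nw ltR leN subR subW Hst Hf.
apply: (triple_sub leN subR subW).
apply: triple_post; first apply: (triple_evolves lt_w).
  rewrite -[lo' in X in triple _ _ _ X]addn0 -(mul0n h).
  apply: (@triple_par_rec _ _ _ _ _ (fun q => iter q (advance adv) r) args).
  - move=> q /Hadv; rewrite iterS /advance; case: pure_run => //.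
  - by move=> q /Hargs.
  - by [].
  - by [].
  - by [].
  - exact: Hst.
  - by move=> q m' /Hf; apply.
by move=> r' m' [[Hr Hq] ev].
Qed.

End Logic.

Arguments triple_par {R P n adv y f xs r args N rb wb lo len m rb' wb' lo' h k s
  ps Q}.

(** * The procedures *)

(** Meant for the coefficients 0, 1, -1. A zero coefficient still takes one instruction, so the
    length of a sum does not depend on its signs. *)
Definition add_term (c : int) : instr :=
  match c with
  | Posz 0 => Un Copy 16 16
  | Posz _.+1 => Bin Plus 16 16 17
  | Negz _ => Bin Minus 16 16 17
  end.

(** Registers: 4 = output pointer, 5 = the word 1, 14 = pointer to the next term, 16 = accumulator,
    17 = current term. The signs are hard-wired in the code. *)
Fixpoint sum_code (cs : seq int) : com :=
  if cs is c :: cs' then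
    Defs.Seq (Do (Read 17 14))
      (prefix_com [:: add_term c; Bin Plus 14 14 5] (sum_code cs'))
  else Do (Write 4 16).

(** Selects a row of a hard-wired table from the three bits of its number, held in registers 7, 9,
    10 from the lowest up. *)
Definition dispatch (k : nat -> com) : com :=
  If 10 (If 9 (If 7 (k 7) (k 6)) (If 7 (k 5) (k 4)))
        (If 9 (If 7 (k 3) (k 2)) (If 7 (k 1) (k 0))).

(** The default 0 gives a meaning to all eight branches of [dispatch], although the tables have only
    seven or four rows. *)
Definition coef (K : seq (seq int)) (p q : nat) : int := nth 0 (nth [::] K p) q.

Definition split_digit : seq instr :=
  [:: Un Odd 7 1; Un Half 8 1; Un Odd 9 8; Un Half 8 8; Un Odd 10 8; Un Half 8 8].

(** Sets 6 = number of remaining digits, 7, 9, 10 = bits of the current digit, 8 = remaining digits,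
    11 = stride times [2 ^ e] (by doublings), 12 = [nq]. *)
Definition eval_prefix (nq e : nat) : seq instr :=
  [:: Const 5 1; Bin Minus 6 0 5] ++ split_digit ++
  [:: Un Copy 11 3] ++ nseq e (Bin Plus 11 11 11) ++ [:: Const 12 nq].

(* Registers: 0 = number of digits, 1 = the digits (base 8), 2 = source pointer,
   3 = source stride, 4 = output pointer. *)
Definition eval_body (nq e : nat) (K : seq (seq int)) (self : nat) : com :=
  If 0
    (prefix_com (eval_prefix nq e)
      (Defs.Seq (Do (Alloc 13 12)) (prefix_com [:: Un Copy 14 13]
        (Defs.Seq (par nq.-1 [:: Bin Plus 2 2 3; Bin Plus 14 14 5]
                    (Call 15 self [:: 6; 8; 2; 11; 14]))
           (prefix_com [:: Zero 16; Un Copy 14 13]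
              (dispatch (fun p => sum_code [seq coef K p q | q <- iota 0 nq])))))))
    (Defs.Seq (Do (Read 5 2)) (Do (Write 4 5))).

(* Registers: 0 = [c], 1 = [4 ^ c] (the number of entries), 2-5 = registers 0-3 of
   [eval_body], 6 = output pointer. *)
Definition entries_body (feval self : nat) : com :=
  If 0
    (prefix_com [:: Const 7 1; Bin Minus 8 0 7; Un Half 9 1; Un Half 9 9]
      (par 3 [:: Bin Plus 4 4 9; Bin Plus 6 6 9]
        (Call 10 self [:: 8; 9; 2; 3; 4; 5; 6])))
    (Call 10 feval [:: 2; 3; 4; 5; 6]).

Definition code8 (ds : seq nat) : nat := foldr (fun p w => p + 8 * w)%N 0%N ds.

(* [ev K nq B ds off st f]: the entry, at the digits [ds] (least significant
   first), of the tensor power of the matrix [K] applied to [f], whose digits are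
   in base [B] and have strides [st], [B * st], ... *)
Fixpoint ev (R : nzRingType) K nq B ds off st (f : nat -> R) : R :=
  if ds is p :: ds' then
    \sum_(0 <= q < nq) ev K nq B ds' (off + q * st)%N (B * st)%N f *~ coef K p q
  else f off.

(** * Specifications of the summation procedures *)

Section Procedures.
Variables (R : nzRingType) (P : program).
Local Open Scope nat_scope.
Implicit Types (r : regs R) (m : memory R) (f : nat -> R).

Lemma sum_code_spec cs N rb wb lo len r m b o (x : nat -> R) (a : R) bo oo :
  (forall i, i < size cs -> cell m b (o + i) = Scal (x i)) ->
  r 14 = Ptr b o -> r 5 = Word 1 -> r 16 = Scal a -> r 4 = Ptr bo oo ->
  all (fun c : int => c \in [:: Posz 0; Posz 1; Negz 0]) cs ->
  (b \in rb) || (N <= b) -> (bo == wb) && within lo len oo || (N <= bo) ->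
  oo < size (blk m bo) ->
  triple P N rb wb lo len (sum_code cs) r m (3 * size cs + 1) (3 * size cs + 1)
    [::] (fun _ m' => m' = put m bo oo
      (Scal (a + \sum_(0 <= i < size cs) x i *~ nth 0 cs i)%R)).
Proof.
elim: cs r o x a => [|c cs IH] r o x a Hx r14 r5 r16 r4 Hc Hb Hw lt_oo /=.
  apply: (triple_write _ _ r4) => //.
  by rewrite r16 big_nil addr0.
case/andP: Hc => Hc Hcs.
apply: (triple_le (k := 1 + (2 + (3 * size cs + 1)))
  (s := 1 + (2 + (3 * size cs + 1)))); [lia | lia |].
apply: (triple_read (v := Scal (x 0)) r14) => //.
  by have := Hx 0 isT; rewrite addn0.
have [r1_16 r1_14 r1_5] : [/\ upd r 17 (Scal (x 0)) 16 = Scal a,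
  upd r 17 (Scal (x 0)) 14 = Ptr b o & upd r 17 (Scal (x 0)) 5 = Word 1] by [].
have [r1_4 r1_17] : upd r 17 (Scal (x 0)) 4 = Ptr bo oo /\
  upd r 17 (Scal (x 0)) 17 = Scal (x 0) by [].
move: (upd r 17 _) r1_16 r1_14 r1_5 r1_4 r1_17 => r1 r1_16 r1_14 r1_5 r1_4 r1_17.
apply: (triple_pure (l := [:: _; _])
  (r1 := upd (upd r1 16 (Scal (a + x 0 *~ c)%R)) 14 (Ptr b (o + 1)))).
  rewrite !inE in Hc; case/or3P: Hc => /eqP-> /=;
    by rewrite /upd /= ?r1_16 ?r1_17 /= ?r1_14 ?r1_5 ?mulr0z ?addr0 ?mulr1z ?mulrN1z.
rewrite big_nat_recl //= addrA.
apply: (IH _ (o + 1)) => // i lt_i; rewrite -addnA add1n.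
exact: (Hx i.+1).
Qed.

Lemma digit_bits p w : p < 8 ->
  [/\ odd (p + 8 * w) = odd p, odd (p + 8 * w)./2 = odd p./2,
      odd (p + 8 * w)./2./2 = odd p./2./2 & (p + 8 * w)./2./2./2 = w].
Proof. by move=> lt_p; split; lia. Qed.

Lemma dispatch_spec k N rb wb lo len r m p c s ps Q : p < 8 ->
  r 7 = Word (odd p) -> r 9 = Word (odd p./2) -> r 10 = Word (odd p./2./2) ->
  triple P N rb wb lo len (k p) r m c s ps Q ->
  triple P N rb wb lo len (dispatch k) r m (3 + c) (3 + s) ps Q.
Proof.
move=> lt_p r7 r9 r10 T.
rewrite -(addnA 1 2) -(addnA 1 1) -(addnA 1 2) -(addnA 1 1).
apply: (triple_if r10); move: lt_p r7 r9 r10 T.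
do 8?[case: p => [|p] //=] => _ r7 r9 r10 T;
  by apply: (triple_if r9); apply: (triple_if r7).
Qed.

Definition shift (v : value R) a : value R :=
  match v with Word w => Word (w + a) | Ptr b o => Ptr b (o + a) | _ => v end.
Definition movable (v : value R) : bool :=
  match v with Word _ | Ptr _ _ => true | _ => false end.

(** The strides in [y], [y'] are never updated, so [x] and [x'] run through arithmetic progressions.
    [y] and [y'] may coincide. *)
Lemma iter_advance x y x' y' r a a' q :
  r y = Word a -> r y' = Word a' -> movable (r x) -> movable (r x') ->
  uniq [:: x; x'; y] -> y' \notin [:: x; x'] ->
  let adv := [:: Bin Plus x x y; Bin Plus x' x' y'] in
  pure_run adv (iter q (advance adv) r) /\
  forall z, iter q (advance adv) r z =
    if z == x then shift (r x) (q * a)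
    else if z == x' then shift (r x') (q * a') else r z.
Proof.
move=> ry ry' mx mx' Hu Hy' adv.
have {Hu} [nxx' nxy nx'y] : [/\ x != x', x != y & x' != y].
  by move: Hu; rewrite /= !inE negb_or andbT => /andP[/andP[]].
have {Hy'} [ny'x ny'x'] : y' != x /\ y' != x'.
  by move: Hy'; rewrite !inE negb_or => /andP.
have key r1 : r1 y = Word a -> r1 y' = Word a' -> movable (r1 x) ->
    movable (r1 x') -> pure_run adv r1 =
      Some (upd (upd r1 x (shift (r1 x) a)) x' (shift (r1 x') a')).
  rewrite /= => -> e'.
  case: (r1 x) => [|w|b o|v] //= _; rewrite /upd e' (negPf ny'x) eq_sym (negPf nxx').
    by case: (r1 x').
  by case: (r1 x').
have E : forall z, iter q (advance adv) r z =
    if z == x then shift (r x) (q * a)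
    else if z == x' then shift (r x') (q * a') else r z.
  elim: q => [|q IH] z.
    rewrite [iter 0 _ _]/=; case: eqP => [->|_];
      first by case: (r x) => // *; rewrite /shift mul0n addn0.
    by case: eqP => [->|//]; case: (r x') => // *; rewrite /shift mul0n addn0.
  have Ex : iter q (advance adv) r x = shift (r x) (q * a) by rewrite IH eqxx.
  have Ex' : iter q (advance adv) r x' = shift (r x') (q * a').
    by rewrite IH eq_sym (negPf nxx') eqxx.
  have shiftS v k i : movable v -> shift (shift v (k * i)) i = shift v (k.+1 * i).
    by case: v => //= *; rewrite -addnA -mulSnr.
  rewrite iterS /advance key; last first.
  - by rewrite Ex'; case: (r x') mx'.
  - by rewrite Ex; case: (r x) mx.
  - by rewrite IH (negPf ny'x) (negPf ny'x').
  - by rewrite IH ![y == _]eq_sym (negPf nxy) (negPf nx'y).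
  rewrite /upd Ex Ex' IH !shiftS //.
  have [->|_] := eqVneq z x'; first by rewrite eq_sym (negPf nxx').
  by case: eqP.
split=> //.
rewrite key ?E //.
- by rewrite ![y == _]eq_sym (negPf nxy) (negPf nx'y).
- by rewrite (negPf ny'x) (negPf ny'x').
- by rewrite eqxx; case: (r x) mx.
- by rewrite eq_sym (negPf nxx') eqxx; case: (r x') mx'.
Qed.

(* The cells read by [eval_body] hold the values of [f]. *)
Fixpoint holds (s : seq (value R)) nq B l off st f : Prop :=
  if l is l'.+1 then
    forall q, q < nq -> holds s nq B l' (off + q * st) (B * st) f
  else nth Undef s off = Scal (f off).

Definition signs (K : seq (seq int)) : bool :=
  all (all (fun c : int => c \in [:: Posz 0; Posz 1; Negz 0])) K.

Lemma signs_coef K p q : signs K -> coef K p q \in [:: Posz 0; Posz 1; Negz 0].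
Proof.
move=> /all_nthP sK; rewrite /coef.
have [lt_p|le_p] := ltnP p (size K); last by rewrite [nth _ K _]nth_default // nth_nil.
have [lt_q|le_q] := ltnP q (size (nth [::] K p)); last by rewrite nth_default.
by have /all_nthP := sK [::] p lt_p; apply.
Qed.

Lemma flatten_nils (T S : Type) (s : seq T) : flatten [seq [::] | _ <- s] = [::] :> seq S.
Proof. by elim: s. Qed.

Lemma eval_prelude nq e l w src st out : e <= 3 -> exists r1 : regs R,
  [/\ pure_run (eval_prefix nq e) (frame [:: Word l.+1; Word w; src; Word st; out])
        = Some r1,
      [/\ r1 5 = Word 1, r1 6 = Word l, r1 7 = Word (odd w), r1 9 = Word (odd w./2)
        & r1 10 = Word (odd w./2./2)] &
      [/\ r1 8 = Word w./2./2./2, r1 11 = Word (2 ^ e * st), r1 12 = Word nq &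
        [/\ r1 2 = src, r1 3 = Word st & r1 4 = out]]].
Proof.
do 4?[case: e => [|e]] => // _; eexists; (split; first reflexivity); split;
  by rewrite // /upd /= ?subn1 ?mul1n //; congr Word; rewrite ?expnS ?expn0; lia.
Qed.

(** A node has at most seven subtrees; growing by 8 instead of 7 per level leaves [100 * 8 ^ l] to
    pay for the constant work of the node. *)
Definition eval_cost l := 100 * 8 ^ l.
Definition eval_span l := 100 * l.+1.

(** Each node allocates [nq] cells, one for the sum of each child, so the children write to disjoint
    cells; the node then combines these cells with the signs of the row given by its digit. *)
Lemma eval_spec nq e K fe l ds off st f bs bo oo m s :
  onth P fe = Some (eval_body nq e K fe) -> 0 < nq <= 7 -> e <= 3 -> signs K ->
  size ds = l -> all (fun p => p < 8) ds ->
  blk m bs = s -> holds s nq (2 ^ e) l off st f ->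
  bs != bo -> bs < size m -> oo < size (blk m bo) ->
  proc P fe [:: Word l; Word (code8 ds); Ptr bs off; Word st; Ptr bo oo]
    m [:: bs] bo oo 1 (eval_cost l) (eval_span l) [::]
    (fun _ m' => cell m' bo oo = Scal (ev K nq (2 ^ e) ds off st f)).
Proof.
case: nq => // n Hf lt_n le_e sK; elim: l ds off st bo oo m => [|l IH] ds off st bo oo m.
  move=> /size0nil-> _ Hs Hh nbs lt_s lt_oo; exists (eval_body n.+1 e K fe) => //.
  apply: (triple_le (k := 1 + (1 + 1)) (s := 1 + (1 + 1))) => //.
  apply: (triple_if (n := 0)) => //=.
  apply: (triple_read (i := off) (v := Scal (f off))) => //.
    by rewrite inE eqxx.
    by rewrite /cell Hs.
  apply: triple_write; [by [] | | by [] |].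
    by rewrite eqxx /within leqnn addn1 leqnn.
  by rewrite cell_put !eqxx.
case: ds => // p ds [sz] /= /andP[lt_p lt_ds] Hs Hh nbs lt_s lt_oo.
exists (eval_body n.+1 e K fe) => //.
have lt_bo := blk_oob lt_oo.
have [b1 b2 b3 b4] := digit_bits (code8 ds) lt_p.
apply: (triple_conv
   (k := 1 + (10 + e + (1 + n.+1 + (1 +
      (n.+1 * (eval_cost l + 4 + 2) + (2 + (3 + (3 * n.+1 + 1))))))))
   (s := 1 + (10 + e + (1 + (1 +
      (eval_span l + 2 + n * (2 + 2) + (2 + (3 + (3 * n.+1 + 1))))))))
   (ps := flatten [seq [::] | q <- iota 0 n.+1] ++ [::])).
- rewrite /eval_cost expnS.
  have : 0 < 8 ^ l by rewrite expn_gt0.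
  have : n * (100 * 8 ^ l) <= 6 * (100 * 8 ^ l) by rewrite leq_mul2r; lia.
  by move: (8 ^ l) => X; clear -lt_n le_e; lia.
- by rewrite /eval_span; clear -lt_n le_e; lia.
- by rewrite flatten_nils.
apply: triple_then; [reflexivity | by [] |].
have [r1 [E1 [r1_5 r1_6 r1_7 r1_9 r1_10] [r1_8 r1_11 r1_12 r1_234]]] :=
  @eval_prelude n.+1 e l (p + 8 * code8 ds) (Ptr bs off) st (Ptr bo oo) le_e.
have -> : 10 + e = size (eval_prefix n.+1 e).
  by rewrite /eval_prefix !size_cat size_nseq /=; clear; lia.
apply: (triple_pure E1); apply: (triple_alloc r1_12).
apply: (triple_pure (l := [:: _])
  (r1 := upd (upd r1 13 (Ptr (size m) 0)) 14 (Ptr (size m) 0))) => //.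
set tmp := size m; set m1 := rcons m _; set r2 := upd (upd r1 _ _) _ _.
have [r2_5 r2_2 r2_3 r2_14] : [/\ r2 5 = Word 1, r2 2 = Ptr bs off, r2 3 = Word st
  & r2 14 = Ptr tmp 0] by case: r1_234.
have adv q := @iter_advance 2 3 14 5 r2 _ _ q r2_3 r2_5.
rewrite r2_2 r2_14 in adv.
have {}adv q := adv q isT isT isT isT.
have lt_s1 : bs < size m1 by rewrite size_rcons ltnW.
apply: triple_seq.
  apply: (triple_par (args := fun q => [:: Word l; Word (code8 ds);
     Ptr bs (off + q * st); Word (2 ^ e * st); Ptr tmp q])
    (rb' := [:: bs]) (wb' := tmp) (lo' := 0) (h := 1)
    (Q := fun q m' => cell m' tmp q =
       Scal (ev K n.+1 (2 ^ e) ds (off + q * st) (2 ^ e * st) f))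
    (ps := fun=> [::])).
  - by move=> q _; have [-> _] := adv q.
  - move=> q _; have [_ E] := adv q.
    rewrite /= !E /= muln1 add0n /r2 /upd /= r1_6 r1_11 r1_8.
    by have [_ _ _ ->] := digit_bits (code8 ds) lt_p.
  - by rewrite size_rcons.
  - by rewrite inE neq_ltn lt_s orbT.
  - by rewrite /= lt_s1.
  - by rewrite size_rcons ltnW.
  - by rewrite /sub_reads /= inE eqxx.
  - by rewrite /sub_writes leqnn.
  - by move=> q ma mb E <-; apply: E; rewrite /within; lia.
  - move=> q m' le_q K'; have [_ e2 e3] := K'.
    rewrite add0n muln1.
    have es : blk m' bs = s.
      by rewrite e3 ?blk_rcons // neq_ltn lt_s.
    apply: IH => //; first exact: Hh.
      by rewrite neq_ltn lt_s.
      by case: K' => le_m' _ _; apply: leq_trans le_m'.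
    by rewrite e2 blk_rcons_last size_nseq.
move=> r3 m3 [[v ->] Hcell [K3 _]]; have [le_m3 e2 e3] := K3.
have [_ E] := adv n.
set r3' := upd _ 15 v.
apply: (triple_pure (l := [:: _; _]) (r1 := upd (upd r3' 16 (Scal 0%R)) 14 (Ptr tmp 0))).
  by rewrite /= /r3' /upd /= !E.
apply: (dispatch_spec lt_p).
- by rewrite /r3' /upd /= E /= /r2 /upd /= r1_7 b1.
- by rewrite /r3' /upd /= E /= /r2 /upd /= r1_9 b2.
- by rewrite /r3' /upd /= E /= /r2 /upd /= r1_10 b3.
rewrite (_ : 3 * n.+1 + 1 = 3 * size [seq coef K p q | q <- iota 0 n.+1] + 1);
  last by rewrite size_map size_iota.
have [r1_2 r1_3 r1_4] := r1_234.
apply: triple_post.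
  apply: (sum_code_spec (b := tmp) (o := 0) (bo := bo) (oo := oo) (a := 0%R)
    (x := fun q => ev K n.+1 (2 ^ e) ds (off + q * st) (2 ^ e * st) f)).
  - by move=> i; rewrite size_map size_iota => lt_i; apply: Hcell.
  - by [].
  - by rewrite /r3' /upd /= E.
  - by [].
  - by rewrite /r3' /upd /= E /= /r2 /upd /= r1_4.
  - by apply/allP => c /mapP[q _ ->]; apply: signs_coef.
  - by rewrite leqnn orbT.
  - by rewrite eqxx /within leqnn addn1 leqnn.
  - rewrite e3 ?blk_rcons //; first by rewrite size_rcons ltnW.
    by rewrite neq_ltn lt_bo.
move=> r' m' ->; rewrite cell_put !eqxx add0r size_map size_iota; congr Scal.
apply: eq_big_nat => q lt_q; congr (_ *~ _)%R.
by rewrite (nth_map 0) ?size_iota // nth_iota.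
Qed.

Lemma expn4_half c : (4 ^ c.+1)./2./2 = 4 ^ c.
Proof. by rewrite expnS; lia. Qed.

Lemma expn8_half c s : (8 ^ c.+1 * s)./2./2./2 = 8 ^ c * s.
Proof. by rewrite expnS; lia. Qed.

(** The subtracted constant makes the bound inductive: it pays for the forks and calls at the inner
    nodes. The later cost functions have the same shape. *)
Definition entries_cost l c := 4 ^ c * (eval_cost l + 13) - 10.
Definition entries_span l c := eval_span l + 3 + 19 * c.

Lemma entries_spec nq e K fe fz l ds c off st f bs bo oo m s :
  onth P fe = Some (eval_body nq e K fe) ->
  onth P fz = Some (entries_body fe fz) ->
  0 < nq <= 7 -> e <= 3 -> signs K ->
  size ds = l -> all (fun p => p < 8) ds -> blk m bs = s ->
  (forall j, j < 4 ^ c -> holds s nq (2 ^ e) l (off + j) st f) ->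
  bs != bo -> bs < size m -> oo + 4 ^ c <= size (blk m bo) ->
  proc P fz [:: Word c; Word (4 ^ c); Word l; Word (code8 ds); Ptr bs off; Word st;
      Ptr bo oo]
    m [:: bs] bo oo (4 ^ c) (entries_cost l c) (entries_span l c) [::]
    (fun _ m' => forall j, j < 4 ^ c ->
       cell m' bo (oo + j) = Scal (ev K nq (2 ^ e) ds (off + j) st f)).
Proof.
move=> He Hz lt_n le_e sK sz lt_ds.
elim: c off oo m => [|c IH] off oo m Hs Hh nbs lt_s le_oo;
  exists (entries_body fe fz) => //.
  have lt_oo : oo < size (blk m bo) by rewrite addn1 in le_oo.
  apply: (triple_conv (k := 1 + (eval_cost l + 2)) (s := 1 + (eval_span l + 2))
    (ps := [::])) => //.
  - by rewrite /entries_cost; clear; lia.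
  - by rewrite /entries_span; clear; lia.
  apply: triple_else; first by [].
  have Hh0 : holds s nq (2 ^ e) l off st f by rewrite -[off]addn0; exact: Hh.
  apply: (triple_call (eval_spec He lt_n le_e sK sz lt_ds Hs Hh0 nbs lt_s lt_oo)) => //.
  - exact: blk_oob lt_oo.
  - by rewrite /sub_reads /= inE eqxx.
  - by rewrite /sub_writes eqxx !leqnn /= orbT.
  by move=> v m' E _ j; rewrite ltnS leqn0 => /eqP->; rewrite !addn0.
have lt_bo : bo < size m.
  apply: (@blk_oob _ _ _ oo); apply: leq_trans le_oo.
  by rewrite -addn1 leq_add2l expn_gt0.
apply: (triple_conv
  (k := 1 + (4 + 4 * (entries_cost l c + 4 + 2)))
  (s := 1 + (4 + (entries_span l c + 2 + 3 * (2 + 2))))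
  (ps := flatten [seq [::] | q <- iota 0 4])) => //.
- rewrite /entries_cost expnS -mulnA; have : 0 < 4 ^ c by rewrite expn_gt0.
  have : 0 < eval_cost l by rewrite /eval_cost muln_gt0 expn_gt0.
  by move: (4 ^ c) (eval_cost l) => x y; clear => y0 x0; nia.
- by rewrite /entries_span; clear; lia.
apply: triple_then; [reflexivity | by [] |].
apply: (triple_pure (l := [:: _; _; _; _])); first reflexivity.
set r1 := upd _ 9 _.
have [r1_9 r1_4 r1_6] : [/\ r1 9 = Word (4 ^ c), r1 4 = Ptr bs off & r1 6 = Ptr bo oo].
  by rewrite /r1 /upd /= expn4_half.
have adv q := @iter_advance 4 9 6 9 r1 _ _ q r1_9 r1_9.
rewrite r1_4 r1_6 in adv.
have {}adv q := adv q isT isT isT isT.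
apply: triple_post; first apply: (triple_par (args := fun q => [:: Word c; Word (4 ^ c);
     Word l; Word (code8 ds); Ptr bs (off + q * 4 ^ c); Word st; Ptr bo (oo + q * 4 ^ c)])
    (rb' := [:: bs]) (wb' := bo) (lo' := oo) (h := 4 ^ c)
    (Q := fun q m' => forall j, j < 4 ^ c ->
       cell m' bo (oo + q * 4 ^ c + j) =
       Scal (ev K nq (2 ^ e) ds (off + q * 4 ^ c + j) st f))
    (ps := fun=> [::])) => //.
- by move=> q _; have [-> _] := adv q.
- move=> q _; have [_ E] := adv q.
  by rewrite /= !E /= /r1 /upd /= expn4_half subn1.
- by rewrite inE eq_sym.
- by rewrite /= lt_s.
- by rewrite /sub_reads /= inE eqxx.
- by rewrite /sub_writes eqxx !leqnn expnS /= leqnn orbT.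
- move=> q ma mb E Hq j lt_j; rewrite E ?Hq //.
  by rewrite /within leq_addr ltn_add2l.
- move=> q m' le_q K'; have [le_m' e2 e3] := K'.
  apply: IH => //.
  + by rewrite e3.
  + move=> j lt_j; rewrite -addnA; apply: Hh; rewrite expnS.
    by move: lt_j le_q; clear; nia.
  + exact: leq_trans le_m'.
  + rewrite e2; apply: leq_trans le_oo; rewrite expnS -addnA leq_add2l.
    by move: le_q; clear; nia.
move=> r' m' [_ Hq _] j lt_j.
have lt_q : j %/ 4 ^ c < 4 by rewrite ltn_divLR ?expn_gt0 // -expnS.
have := Hq _ (lt_q : j %/ 4 ^ c <= 3) (j %% 4 ^ c); rewrite -!addnA -divn_eq; apply.
by rewrite ltn_mod expn_gt0.
Qed.

(** Computes [(2 ^ e) ^ l * s] by doublings, as words cannot be multiplied. *)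
Definition pow_body (e self : nat) : com :=
  If 0
    (prefix_com ([:: Const 2 1; Bin Minus 0 0 2] ++ nseq e (Bin Plus 1 1 1))
       (Call 0 self [:: 0; 1]))
    (Do (Un Copy 0 1)).

Lemma pow_spec e fe l s m wb lo : 0 < e <= 3 -> wb < size m ->
  onth P fe = Some (pow_body e fe) ->
  proc P fe [:: Word l; Word s] m [::] wb lo 0 (8 * l + 2) (8 * l + 2) [::]
    (fun v m' => v = Word ((2 ^ e) ^ l * s) /\ m' = m).
Proof.
move=> le_e lt_w He; elim: l s => [|l IH] s; exists (pow_body e fe) => //.
  apply: (triple_conv (k := 1 + 1) (s := 1 + 1) (ps := [::])) => //.
  apply: triple_else; first by [].
  have st : step (Un Copy 0 1) (frame [:: Word 0; Word s]) m =
    Some (upd (frame [:: Word 0; Word s]) 0 (Word s), m, ENone R) by [].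
  by apply: triple_do_pure; [exact: st | rewrite expn0 mul1n].
pose prefix := [:: Const 2 1; Bin Minus 0 0 2] ++ nseq e (Bin Plus 1 1 1).
apply: (triple_le (k := 1 + (size prefix + (8 * l + 2 + 2)))
  (s := 1 + (size prefix + (8 * l + 2 + 2)))).
- by rewrite /prefix size_cat size_nseq /=; move: le_e; clear; lia.
- by rewrite /prefix size_cat size_nseq /=; move: le_e; clear; lia.
apply: triple_then; [reflexivity | by [] |].
have [r1 [E1 r1_0 r1_1]] : exists r1, [/\
    pure_run ([:: Const 2 1; Bin Minus 0 0 2] ++ nseq e (Bin Plus 1 1 1))
      (frame [:: Word l.+1; Word s]) = Some r1,
    r1 0 = Word l & r1 1 = Word (2 ^ e * s)].
  move: le_e; clear; do 4?[case: e => [|e]] => // _; eexists;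
    (split; first reflexivity); rewrite // /upd /= ?subn1 //; congr Word;
    rewrite ?expnS ?expn0; lia.
apply: (triple_pure E1); apply: (triple_call (IH (2 ^ e * s))) => //.
- by rewrite /= r1_0 r1_1.
- by rewrite /sub_writes /= !orbT.
by move=> v m' [-> ->] _; rewrite expnSr mulnA.
Qed.

End Procedures.

(** * The recursive multiplication *)

(* The products are [M1], ..., [M7]; the blocks of a matrix are listed as 11, 12,
   21, 22. *)
Definition tabA : seq (seq int) :=
  [:: [:: Posz 1; Posz 0; Posz 0; Posz 1]; [:: Posz 0; Posz 0; Posz 1; Posz 1];
      [:: Posz 1; Posz 0; Posz 0; Posz 0]; [:: Posz 0; Posz 0; Posz 0; Posz 1];
      [:: Posz 1; Posz 1; Posz 0; Posz 0]; [:: Negz 0; Posz 0; Posz 1; Posz 0];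
      [:: Posz 0; Posz 1; Posz 0; Negz 0]].
Definition tabB : seq (seq int) :=
  [:: [:: Posz 1; Posz 0; Posz 0; Posz 1]; [:: Posz 1; Posz 0; Posz 0; Posz 0];
      [:: Posz 0; Posz 1; Posz 0; Negz 0]; [:: Negz 0; Posz 0; Posz 1; Posz 0];
      [:: Posz 0; Posz 0; Posz 0; Posz 1]; [:: Posz 1; Posz 1; Posz 0; Posz 0];
      [:: Posz 0; Posz 0; Posz 1; Posz 1]].
Definition tabC : seq (seq int) :=
  [:: [:: Posz 1; Posz 0; Posz 0; Posz 1; Negz 0; Posz 0; Posz 1];
      [:: Posz 0; Posz 0; Posz 1; Posz 0; Posz 1; Posz 0; Posz 0];
      [:: Posz 0; Posz 1; Posz 0; Posz 1; Posz 0; Posz 0; Posz 0];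
      [:: Posz 1; Negz 0; Posz 1; Posz 0; Posz 0; Posz 1; Posz 0]].

(* Registers: 0 = number of digits to be chosen, 1 = chosen digits, 2 = number of
   entries of the current part of the output, 3 = number of digits of the entries
   of a subproblem, 4 = their number, 5 = total number of chosen digits,
   6 = subproblem results, 7 = output. *)
Definition outputs_body (fz self : nat) : com :=
  If 0
    (prefix_com [:: Const 8 1; Bin Minus 9 0 8; Un Half 10 2; Un Half 10 10;
        Bin Plus 11 1 1; Bin Plus 11 11 11; Bin Plus 11 11 11]
      (par 3 [:: Bin Plus 11 11 8; Bin Plus 7 7 10]
        (Call 12 self [:: 9; 11; 10; 3; 4; 5; 6; 7])))
    (Call 12 fz [:: 3; 4; 5; 1; 6; 4; 7]).

(* Registers 0-5 as in [outputs_body], 6, 7 = factors, 8 = results. *)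
Definition products_body (fzA fzB fmul self : nat) : com :=
  If 0
    (prefix_com [:: Const 9 1; Bin Minus 10 0 9; Un Half 11 2; Un Half 11 11;
        Un Half 11 11; Bin Plus 12 1 1; Bin Plus 12 12 12; Bin Plus 12 12 12]
      (par 6 [:: Bin Plus 12 12 9; Bin Plus 8 8 11]
        (Call 13 self [:: 10; 12; 11; 3; 4; 5; 6; 7; 8])))
    (Defs.Seq (Do (Alloc 9 4)) (Defs.Seq (Do (Alloc 10 4))
      (Defs.Seq (Call 11 fzA [:: 3; 4; 5; 1; 6; 4; 9])
        (Defs.Seq (Call 11 fzB [:: 3; 4; 5; 1; 7; 4; 10])
          (Call 11 fmul [:: 3; 9; 10; 8]))))).

(* Registers: 0 = [a], 1, 2 = factors, 3 = result, 5 = [t], 6 = [b], 8 = [4 ^ b],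
   10 = results of the subproblems. *)
Definition multiply_body (fpow4 fpow8 fprod fout : nat) : com :=
  If 0
    (prefix_com [:: Const 4 7; Bin Plus 5 0 4; Un Half 5 5; Un Half 5 5; Un Half 5 5;
        Bin Minus 6 0 5; Const 7 1]
      (Defs.Seq (Call 8 fpow4 [:: 6; 7]) (Defs.Seq (Call 9 fpow8 [:: 5; 8])
        (Defs.Seq (Do (Alloc 10 9)) (prefix_com [:: Const 11 0]
          (Defs.Seq (Call 12 fprod [:: 5; 11; 9; 6; 8; 5; 1; 2; 10])
            (Defs.Seq (Call 13 fpow4 [:: 5; 8])
              (Call 12 fout [:: 5; 11; 13; 6; 8; 5; 10; 3]))))))))
    (Defs.Seq (Do (Read 4 1)) (Defs.Seq (Do (Read 5 2))
      (Defs.Seq (Do (Bin Times 6 4 5)) (Do (Write 3 6))))).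

(** * Strassen's recursion on vectors and the tensor powers of its tables *)

Section Recursion.
Variable R : nzRingType.
Implicit Types f g : nat -> R.

Definition lin K p s f : nat -> R :=
  fun o => \sum_(0 <= q < 4) f (o + q * s)%N *~ coef K p q.

(* Strassen's algorithm on matrices stored as vectors: the four quadrants of a
   matrix are stored one after the other, recursively. *)
Fixpoint sv k f g : nat -> R :=
  if k is k'.+1 then fun i =>
    \sum_(0 <= p < 7)
      sv k' (lin tabA p (4 ^ k') f) (lin tabB p (4 ^ k') g) (i %% 4 ^ k')%N
        *~ coef tabC (i %/ 4 ^ k')%N p
  else fun _ => f 0%N * g 0%N.

Fixpoint svp k f g : seq (R * R) :=
  if k is k'.+1 then
    flatten [seq svp k' (lin tabA p (4 ^ k') f) (lin tabB p (4 ^ k') g) | p <- iota 0 7]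
  else [:: (f 0%N, g 0%N)].

(** [ev] is defined by peeling the digit of smallest stride, whereas the outermost level of
    Strassen's recursion has the largest one. Exchanging the sums reconciles the two orders. *)
Lemma ev_rcons K nq B e q off st f :
  ev K nq B (rcons e q) off st f =
  \sum_(0 <= p < nq) ev K nq B e (off + p * (B ^ size e * st))%N st f *~ coef K q p.
Proof.
elim: e off st => [|p0 e IH] off st /=.
  by apply: eq_bigr => p _; rewrite expn0 mul1n.
under eq_bigr do rewrite IH mulrz_suml.
rewrite exchange_big /=; apply: eq_bigr => p _; rewrite mulrz_suml.
apply: eq_bigr => p1 _; rewrite mulrzAC; congr (ev _ _ _ _ _ _ _ *~ _ *~ _).
by rewrite expnS; lia.
Qed.

Local Open Scope nat_scope.

Definition code4 (e : seq nat) : nat := foldr (fun p w => p + 4 * w) 0 e.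

Lemma code4_rcons e q : code4 (rcons e q) = code4 e + 4 ^ size e * q.
Proof.
by elim: e => [|p e IH] /=; rewrite ?muln0 ?expn0 ?mul1n ?addn0 // IH expnS; lia.
Qed.

Lemma code4_lt e : all (fun p => p < 4) e -> code4 e < 4 ^ size e.
Proof. by elim: e => //= p e IH /andP[lt_p /IH]; rewrite expnS; lia. Qed.

(* A subproblem is located by base-8 digits, although there are only seven
   products: the slots with a digit 7 are never written. *)
Fixpoint filled l b f g (w : nat -> value R) mo : Prop :=
  if l is l'.+1 then forall p, p < 7 ->
    filled l' b (lin tabA p (4 ^ (l' + b)) f) (lin tabB p (4 ^ (l' + b)) g) w
      (mo + p * (8 ^ l' * 4 ^ b))
  else forall i, i < 4 ^ b -> w (mo + i) = Scal (sv b f g i).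

Lemma eq_filled l b f g w w' mo :
  (forall i, within mo (8 ^ l * 4 ^ b) i -> w' i = w i) ->
  filled l b f g w mo -> filled l b f g w' mo.
Proof.
elim: l f g mo => [|l IH] f g mo E /= H.
  by move=> i lt_i; rewrite E ?H // expn0 mul1n /within leq_addr ltn_add2l.
move=> p lt_p; apply: IH (H p lt_p) => i; rewrite /within => Hi; apply: E.
by rewrite /within expnS; move: lt_p Hi; clear; nia.
Qed.

Lemma holds_rcons (s : seq (value R)) nq B l off st f :
  (forall q, q < nq -> holds s nq B l (off + q * (B ^ l * st)) st f) ->
  holds s nq B l.+1 off st f.
Proof.
elim: l off st => [|l IH] off st H.
  by move=> q lt_q /=; have := H q lt_q; rewrite expn0 mul1n.
move=> q lt_q; apply: IH => p lt_p; have := H p lt_p q lt_q.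
by congr holds; rewrite expnS; lia.
Qed.

(** With digits below [B], the largest index reached is at most [off + st * (B ^ l - 1)]; the last
    hypothesis bounds it by [N] without subtraction. *)
Lemma holds_vec (s : seq (value R)) n B l off st f N :
  (forall i, i < N -> nth Undef s i = Scal (f i)) -> n <= B ->
  off + st * B ^ l < N + st -> holds s n B l off st f.
Proof.
move=> H le_n; elim: l off st => [|l IH] off st /= lt_o.
  by apply: H; rewrite expn0 muln1 in lt_o; lia.
move=> q lt_q; apply: IH; move: lt_o; rewrite expnS.
have : q.+1 * st <= B * st by rewrite leq_mul2r; apply/orP; right; lia.
by move: (B ^ l) => x; clear; nia.
Qed.

Definition scal_of (v : value R) : R := if v is Scal a then a else 0%R.

Lemma filled_holds l b f g (s : seq (value R)) mo z : z < 4 ^ b ->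
  filled l b f g (nth Undef s) mo ->
  holds s 7 8 l (mo + z) (4 ^ b) (fun o => scal_of (nth Undef s o)).
Proof.
move=> lt_z; elim: l f g mo => [|l IH] f g mo /= H; first by rewrite H.
by apply: holds_rcons => q lt_q; rewrite addnAC; apply: IH; apply: H.
Qed.

(** Applying the tensor power of [tabC] to the subproblem results undoes [l] levels of [sv]. The
    last digit of [e] is the outermost quadrant, so the induction peels it off, in step with
    [filled]. *)
Lemma filled_ev l b f g w mo e z : z < 4 ^ b -> size e = l ->
  all (fun p => p < 4) e -> filled l b f g w mo ->
  ev tabC 7 8 e (mo + z) (4 ^ b) (fun o => scal_of (w o)) =
  sv (l + b) f g (z + 4 ^ b * code4 e).
Proof.
move=> lt_z; elim/last_ind: e l f g mo => [|e q IH] l f g mo.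
  by move=> <- _ /= ->; rewrite ?muln0 ?addn0.
rewrite size_rcons all_rcons => <- /andP[lt_q lt_e] /= H.
rewrite ev_rcons code4_rcons.
have lt_i : z + 4 ^ b * code4 e < 4 ^ (size e + b).
  by move: (code4_lt lt_e) lt_z; rewrite expnD; clear; nia.
have -> : z + 4 ^ b * (code4 e + 4 ^ size e * q) =
    q * 4 ^ (size e + b) + (z + 4 ^ b * code4 e) by rewrite expnD; lia.
rewrite modnMDl divnMDl ?expn_gt0 // divn_small // modn_small // addn0.
apply: eq_big_nat => p lt_p; congr (_ *~ _)%R.
by rewrite addnAC; apply: IH => //; apply: H.
Qed.

Definition vec (m : memory R) b N f : Prop :=
  forall i, i < N -> cell m b i = Scal (f i).

Lemma cell_lt (m : memory R) b o (a : R) : cell m b o = Scal a -> b < size m.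
Proof.
move=> e; rewrite ltnNge; apply/negP => le_b.
by move: e; rewrite /cell /blk [nth [::] _ _]nth_default // nth_nil.
Qed.

Lemma vec_lt m b N f : vec m b N f -> 0 < N -> b < size m.
Proof. by move=> V N0; apply: cell_lt (V 0 N0). Qed.

Lemma vec_keeps wb m m' b N f :
  keeps wb m m' -> b < size m -> b != wb -> vec m b N f -> vec m' b N f.
Proof. by move=> [_ _ e] lt_b nb V i lt_i; rewrite /cell e //; apply: V. Qed.

End Recursion.

(** * One stage: factors, recursive products, combination *)

Section Multiply.
Variables (R : nzRingType) (P : program).
Local Open Scope nat_scope.
Implicit Types (m : memory R) (f g : nat -> R).

Definition outputs_cost t b l := 4 ^ l * (entries_cost t b + 14) - 11.
Definition outputs_span t b l := entries_span t b + 3 + 22 * l.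

Lemma outputs_spec fe fz fo t b l ds bm bo mo oo m s f :
  onth P fe = Some (eval_body 7 3 tabC fe) ->
  onth P fz = Some (entries_body fe fz) ->
  onth P fo = Some (outputs_body fz fo) ->
  size ds + l = t -> all (fun p => p < 8) ds -> blk m bm = s ->
  (forall z, z < 4 ^ b -> holds s 7 8 t (mo + z) (4 ^ b) f) ->
  bm != bo -> bm < size m -> oo + 4 ^ (l + b) <= size (blk m bo) ->
  proc P fo [:: Word l; Word (code8 ds); Word (4 ^ (l + b)); Word b; Word (4 ^ b);
      Word t; Ptr bm mo; Ptr bo oo]
    m [:: bm] bo oo (4 ^ (l + b)) (outputs_cost t b l) (outputs_span t b l) [::]
    (fun _ m' => forall e z, size e = l -> all (fun p => p < 4) e -> z < 4 ^ b ->
       cell m' bo (oo + (z + 4 ^ b * code4 e)) =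
       Scal (ev tabC 7 8 (e ++ ds) (mo + z) (4 ^ b) f)).
Proof.
move=> He Hz Ho.
elim: l ds oo m => [|l IH] ds oo m sz lt_ds Hs Hh nbm lt_m le_oo;
  exists (outputs_body fz fo) => //.
  apply: (triple_conv (k := 1 + (entries_cost t b + 2))
    (s := 1 + (entries_span t b + 2)) (ps := [::])) => //.
  - by rewrite /outputs_cost; clear; lia.
  - by rewrite /outputs_span; clear; lia.
  rewrite addn0 in sz; rewrite add0n in le_oo.
  apply: triple_else; first by [].
  apply: (triple_call (entries_spec He Hz isT isT isT sz lt_ds Hs Hh nbm lt_m le_oo)) => //.
  - apply: (@blk_oob _ _ _ oo); apply: leq_trans le_oo.
    by rewrite -addn1 leq_add2l expn_gt0.
  - by rewrite /sub_reads /= inE eqxx.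
  - by rewrite /sub_writes eqxx !leqnn /= orbT.
  move=> v m' E _ e z /size0nil-> _ lt_z; rewrite /= muln0 addn0; exact: E.
have lt_bo : bo < size m.
  apply: (@blk_oob _ _ _ oo); apply: leq_trans le_oo.
  by rewrite -addn1 leq_add2l expn_gt0.
apply: (triple_conv
  (k := 1 + (7 + 4 * (outputs_cost t b l + 4 + 2)))
  (s := 1 + (7 + (outputs_span t b l + 2 + 3 * (2 + 2))))
  (ps := flatten [seq [::] | q <- iota 0 4])) => //.
- rewrite /outputs_cost expnS -mulnA; have : 0 < 4 ^ l by rewrite expn_gt0.
  by move: (4 ^ l) (entries_cost t b) => x y; clear => x0; nia.
- by rewrite /outputs_span; clear; lia.
apply: triple_then; [reflexivity | by [] |].
apply: (triple_pure (l := [:: _; _; _; _; _; _; _])); first reflexivity.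
set r1 := upd _ 11 _.
have h4 : (4 ^ (l.+1 + b))./2./2 = 4 ^ (l + b) by rewrite addSn expn4_half.
have [r1_8 r1_10 r1_11 r1_7] : [/\ r1 8 = Word 1, r1 10 = Word (4 ^ (l + b)),
    r1 11 = Word (8 * code8 ds) & r1 7 = Ptr bo oo].
  by split=> //; rewrite /r1 /upd /= ?h4 //; congr Word; clear; lia.
have adv q := @iter_advance _ 11 8 7 10 r1 _ _ q r1_8 r1_10.
rewrite r1_11 r1_7 in adv.
have {}adv q := adv q isT isT isT isT.
apply: triple_post; first apply: (triple_par (args := fun q => [:: Word l;
     Word (code8 (q :: ds)); Word (4 ^ (l + b)); Word b; Word (4 ^ b); Word t;
     Ptr bm mo; Ptr bo (oo + q * 4 ^ (l + b))])
    (rb' := [:: bm]) (wb' := bo) (lo' := oo) (h := 4 ^ (l + b))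
    (Q := fun q m' => forall e z, size e = l -> all (fun p => p < 4) e -> z < 4 ^ b ->
       cell m' bo (oo + q * 4 ^ (l + b) + (z + 4 ^ b * code4 e)) =
       Scal (ev tabC 7 8 (e ++ q :: ds) (mo + z) (4 ^ b) f))
    (ps := fun=> [::])) => //.
- by move=> q _; have [-> _] := adv q.
- move=> q _; have [_ E] := adv q.
  by rewrite /= !E /= /r1 /upd /= h4 subn1 muln1 addnC.
- by rewrite inE eq_sym.
- by rewrite /= lt_m.
- by rewrite /sub_reads /= inE eqxx.
- by rewrite /sub_writes eqxx !leqnn addSn expnS /= leqnn orbT.
- move=> q ma mb E Hq e z se lt_e lt_z; rewrite E ?Hq // /within leq_addr ltn_add2l.
  by move: (code4_lt lt_e) lt_z; rewrite se expnD; clear; nia.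
- move=> q m' le_q K'; have [le_m' e2 e3] := K'.
  apply: IH => //.
  + by rewrite /= addSnnS.
  + by rewrite /= lt_ds andbT; apply: leq_trans le_q _.
  + by rewrite e3.
  + exact: leq_trans le_m'.
  + rewrite e2; apply: leq_trans le_oo; rewrite addSn expnS -addnA leq_add2l.
    by move: le_q; clear; nia.
(* The digit chosen here is the most significant of those still open, hence the last one of [e]. *)
move=> r' m' [_ Hq _] e z; case/lastP: e => // e q; rewrite size_rcons all_rcons.
move=> [se] /andP[lt_q lt_e] lt_z; rewrite cat_rcons -(Hq q) // code4_rcons se expnD.
by congr cell; lia.
Qed.

(** The factors fill blocks from offset 0, whereas the result goes to an interval of a block that
    sibling subproblems may share; hence [ox]. *)
Definition multiplies fm c k s : Prop :=
  forall m bu bv bx ox f g,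
  vec m bu (4 ^ c) f -> vec m bv (4 ^ c) g -> bu != bx -> bv != bx ->
  ox + 4 ^ c <= size (blk m bx) ->
  proc P fm [:: Word c; Ptr bu 0; Ptr bv 0; Ptr bx ox] m [:: bu; bv] bx ox (4 ^ c)
    k s (svp c f g)
    (fun _ m' => forall i, i < 4 ^ c -> cell m' bx (ox + i) = Scal (sv c f g i)).

Definition products_cost t b k l :=
  7 ^ l * (2 * 4 ^ b + 2 * entries_cost t b + k + 18) - 9.
Definition products_span t b s l := 2 * entries_span t b + s + 9 + 35 * l.

(** [F] and [G] are the factors at the current node of the tree of subproblems. They are never
    stored at inner nodes: a leaf allocates two blocks, evaluates both factors into them from the
    original inputs, and calls the recursion. *)
Lemma products_spec feA fzA feB fzB fm fp t b k s l ds m bu bv bm mo f g :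
  onth P feA = Some (eval_body 4 2 tabA feA) ->
  onth P fzA = Some (entries_body feA fzA) ->
  onth P feB = Some (eval_body 4 2 tabB feB) ->
  onth P fzB = Some (entries_body feB fzB) ->
  onth P fp = Some (products_body fzA fzB fm fp) ->
  multiplies fm b k s ->
  size ds + l = t -> all (fun p => p < 8) ds ->
  vec m bu (4 ^ (t + b)) f -> vec m bv (4 ^ (t + b)) g ->
  bu != bm -> bv != bm -> mo + 8 ^ l * 4 ^ b <= size (blk m bm) ->
  let F := fun o => ev tabA 4 4 ds o (4 ^ (l + b)) f in
  let G := fun o => ev tabB 4 4 ds o (4 ^ (l + b)) g in
  proc P fp [:: Word l; Word (code8 ds); Word (8 ^ l * 4 ^ b); Word b; Word (4 ^ b);
      Word t; Ptr bu 0; Ptr bv 0; Ptr bm mo]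
    m [:: bu; bv] bm mo (8 ^ l * 4 ^ b)
    (products_cost t b k l) (products_span t b s l) (svp (l + b) F G)
    (fun _ m' => filled l b F G (cell m' bm) mo).
Proof.
move=> HeA HzA HeB HzB Hp Hm.
elim: l ds m mo => [|l IH] ds m mo sz lt_ds Vu Vv nu nv le_mo F G;
  exists (products_body fzA fzB fm fp) => //.
all: have lt_u : bu < size m by apply: vec_lt Vu _; rewrite expn_gt0.
all: have lt_v : bv < size m by apply: vec_lt Vv _; rewrite expn_gt0.
all: have lt_b : bm < size m
  by apply: (@blk_oob _ _ _ mo); apply: leq_trans le_mo;
     rewrite -addn1 leq_add2l muln_gt0 !expn_gt0.
  rewrite addn0 in sz; rewrite expn0 mul1n in le_mo *.
  apply: (triple_conv
    (k := 1 + ((1 + 4 ^ b) + ((1 + 4 ^ b) + (entries_cost t b + 2 +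
       (entries_cost t b + 2 + (k + 2))))))
    (s := 1 + (1 + (1 + (entries_span t b + 2 + (entries_span t b + 2 + (s + 2))))))
    (ps := [::] ++ [::] ++ svp b F G)) => //.
  - by rewrite /products_cost; clear; lia.
  - by rewrite /products_span; clear; lia.
  apply: triple_else; first by [].
  apply: triple_alloc; first by [].
  apply: triple_alloc; first by [].
  set m2 := rcons (rcons _ _) _; set r2 := upd _ 10 _.
  have sz2 : size m2 = (size m).+2 by rewrite !size_rcons.
  have bL : blk m2 (size m) = nseq (4 ^ b) Undef.
    by rewrite blk_rcons ?size_rcons // blk_rcons_last.
  have bR : blk m2 (size m).+1 = nseq (4 ^ b) Undef.
    by rewrite -(size_rcons m (nseq (4 ^ b) Undef)) blk_rcons_last.
  have old b0 : b0 < size m -> blk m2 b0 = blk m b0.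
    by move=> lt_b0; rewrite !blk_rcons // size_rcons ltnW.
  have HhA j : j < 4 ^ b -> holds (blk m2 bu) 4 (2 ^ 2) t (0 + j) (4 ^ b) f.
    move=> lt_j; apply: (@holds_vec _ _ _ _ _ _ _ _ (4 ^ (t + b))) => //.
      by rewrite old.
    by rewrite add0n expnD mulnC addnC ltn_add2l.
  have HhB m3 : keeps (size m) m2 m3 ->
      forall j, j < 4 ^ b -> holds (blk m3 bv) 4 (2 ^ 2) t (0 + j) (4 ^ b) g.
    move=> [_ _ e] j lt_j; apply: (@holds_vec _ _ _ _ _ _ _ _ (4 ^ (t + b))) => //.
      by rewrite e ?sz2 ?neq_ltn ?lt_v // ?old // ltnW // ltnW.
    by rewrite add0n expnD mulnC addnC ltn_add2l.
  have lt_u2 : bu < size m2 by rewrite sz2 ltnW // ltnW.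
  have lt_v2 : bv < size m2 by rewrite sz2 ltnW // ltnW.
  apply: (triple_call_seq (entries_spec (bo := size m) (oo := 0) (c := b) HeA HzA
    isT isT isT sz lt_ds (erefl (blk m2 bu)) HhA _ _ _)) => //.
  - by rewrite neq_ltn lt_u.
  - by rewrite bL size_nseq.
  - by rewrite sz2 ltnW.
  - by rewrite sz2 ltnW // ltnW.
  - by rewrite /sub_reads /= inE eqxx.
  - by rewrite /sub_writes leqnn.
  move=> v3 m3 HL [K3 _]; have [le3 s3 e3] := K3.
  have lt_R : (size m).+1 < size m3 by apply: leq_trans le3; rewrite sz2.
  have neRL : (size m).+1 != size m by rewrite neq_ltn ltnSn orbT.
  apply: (triple_call_seq (entries_spec (bo := (size m).+1) (oo := 0) (c := b) HeB HzB
    isT isT isT sz lt_ds (erefl (blk m3 bv)) (HhB _ K3) _ _ _)) => //.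
  - by rewrite neq_ltn ltnW.
  - exact: leq_trans le3.
  - by rewrite e3 ?sz2 // bR size_nseq.
  - by rewrite /r2 /upd /= size_rcons.
  - by apply: leq_trans le3; rewrite sz2 ltnW.
  - by rewrite /sub_reads /= !inE eqxx orbT.
  - by rewrite /sub_writes leqnSn.
  move=> v4 m4 HR [K4 _]; have [le4 s4 e4] := K4.
  have lt_b1 : bm < (size m).+1 by rewrite ltnW.
  have lt_b3 : bm < size m3 by apply: leq_trans le3; rewrite sz2 ltnW.
  apply: (triple_call (Hm m4 (size m) (size m).+1 bm mo F G _ _ _ _ _)) => //.
  - move=> i lt_i; rewrite /cell e4 1?eq_sym //; first exact: HL.
    exact: ltnW lt_R.
  - by rewrite neq_ltn lt_b orbT.
  - by rewrite neq_ltn lt_b1 orbT.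
  - have nb1 : bm != (size m).+1 by rewrite neq_ltn lt_b1.
    have nb0 : bm != size m by rewrite neq_ltn lt_b.
    have lt_b2 : bm < size m2 by rewrite sz2 ltnW.
    by rewrite (e4 _ lt_b3 nb1) (e3 _ lt_b2 nb0) old.
  - by rewrite /r2 /upd /= size_rcons.
  - by apply: leq_trans le4; apply: leq_trans le3; rewrite sz2 ltnW.
  - by apply: leq_trans le4; apply: leq_trans le3; rewrite sz2 ltnW // ltnW.
  - by rewrite /sub_reads /= leqnn leqnSn !orbT.
  by rewrite /sub_writes eqxx !leqnn /= orbT.
(* The latest choice is the first digit and has the smallest stride, so one level of the recursion
   is one unfolding of [ev]. *)
have EF p : lin tabA p (4 ^ (l + b)) F = fun o => ev tabA 4 4 (p :: ds) o (4 ^ (l + b)) f.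
  by rewrite /F addSn expnS.
have EG p : lin tabB p (4 ^ (l + b)) G = fun o => ev tabB 4 4 (p :: ds) o (4 ^ (l + b)) g.
  by rewrite /G addSn expnS.
apply: (triple_conv
  (k := 1 + (8 + 7 * (products_cost t b k l + 4 + 2)))
  (s := 1 + (8 + (products_span t b s l + 2 + 6 * (2 + 2))))
  (ps := flatten [seq svp (l + b) (lin tabA q (4 ^ (l + b)) F)
     (lin tabB q (4 ^ (l + b)) G) | q <- iota 0 7])) => //.
- rewrite /products_cost expnS -mulnA; have : 0 < 7 ^ l by rewrite expn_gt0.
  by move: (7 ^ l) (_ + 18) (leq_addl (2 * 4 ^ b + 2 * entries_cost t b + k) 18) => x y;
    clear => y0 x0; nia.
- by rewrite /products_span; clear; lia.
apply: triple_then; [reflexivity | by [] |].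
apply: (triple_pure (l := [:: _; _; _; _; _; _; _; _])); first reflexivity.
set r1 := upd _ 12 _.
have h8 := expn8_half l (4 ^ b).
have [r1_9 r1_11 r1_12 r1_8] : [/\ r1 9 = Word 1, r1 11 = Word (8 ^ l * 4 ^ b),
    r1 12 = Word (8 * code8 ds) & r1 8 = Ptr bm mo].
  by split=> //; rewrite /r1 /upd /= ?h8 //; congr Word; clear; lia.
have adv q := @iter_advance _ 12 9 8 11 r1 _ _ q r1_9 r1_11.
rewrite r1_12 r1_8 in adv.
have {}adv q := adv q isT isT isT isT.
apply: triple_post; first apply: (triple_par (args := fun q => [:: Word l;
     Word (code8 (q :: ds)); Word (8 ^ l * 4 ^ b); Word b; Word (4 ^ b); Word t;
     Ptr bu 0; Ptr bv 0; Ptr bm (mo + q * (8 ^ l * 4 ^ b))])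
    (rb' := [:: bu; bv]) (wb' := bm) (lo' := mo) (h := 8 ^ l * 4 ^ b)
    (Q := fun q m' => filled l b (lin tabA q (4 ^ (l + b)) F)
       (lin tabB q (4 ^ (l + b)) G) (cell m' bm) (mo + q * (8 ^ l * 4 ^ b)))
    (ps := fun q => svp (l + b) (lin tabA q (4 ^ (l + b)) F)
       (lin tabB q (4 ^ (l + b)) G))) => //.
- by move=> q _; have [-> _] := adv q.
- move=> q _; have [_ E] := adv q.
  by rewrite /= !E /= /r1 /upd /= h8 subn1 muln1 addnC.
- by rewrite !inE !(eq_sym bm) negb_or nu.
- by rewrite /= lt_u lt_v.
- by rewrite /sub_reads /= !inE !eqxx orbT.
- rewrite /sub_writes eqxx leqnn /= expnS -mulnA leq_add2l leq_mul2r.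
  by rewrite orbT orbT.
- by move=> q ma mb E; apply: eq_filled.
- move=> q m' le_q K'; have [le_m' e2 e3] := K'.
  rewrite EF EG; apply: IH => //.
  + by rewrite /= addSnnS.
  + by rewrite /= lt_ds andbT; apply: leq_trans le_q _.
  + exact: vec_keeps K' _ _ Vu.
  + exact: vec_keeps K' _ _ Vv.
  + rewrite e2; apply: leq_trans le_mo; rewrite expnS -addnA leq_add2l -mulnA.
    by move: le_q (8 ^ l * 4 ^ b); clear; nia.
by move=> r' m' [_ Hq _] p lt_p; apply: Hq.
Qed.

Lemma code4_surj t n : n < 4 ^ t ->
  exists e, [/\ size e = t, all (fun p => p < 4) e & code4 e = n].
Proof.
elim: t n => [|t IH] n; first by rewrite ltnS leqn0 => /eqP->; exists [::].
rewrite expnS => lt_n; have [|e [se lt_e ce]] := IH (n %/ 4).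
  by rewrite ltn_divLR // mulnC.
exists (n %% 4 :: e); split=> /=; [by rewrite se | by rewrite lt_e ltn_mod |].
by rewrite ce addnC mulnC -divn_eq.
Qed.

Lemma multiplies0 fm fpow4 fpow8 fprod fout :
  onth P fm = Some (multiply_body fpow4 fpow8 fprod fout) ->
  multiplies fm 0 5 5.
Proof.
move=> Hm m bu bv bx ox f g Vu Vv nu nv le_o.
exists (multiply_body fpow4 fpow8 fprod fout) => //.
apply: (triple_conv (k := 1 + (1 + (1 + (1 + 1)))) (s := 1 + (1 + (1 + (1 + 1))))
   (ps := [:: (f 0, g 0)])) => //.
apply: triple_else; first by [].
apply: triple_read; [reflexivity | by rewrite inE eqxx | exact: Vu | by [] |].
apply: triple_read; [reflexivity | by rewrite !inE eqxx orbT | exact: Vv | by [] |].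
apply: triple_times; [reflexivity | reflexivity |].
apply: triple_write; [reflexivity | | by rewrite addn1 in le_o |].
  by rewrite eqxx /within leqnn addn1 leqnn.
by move=> i; rewrite ltnS leqn0 => /eqP->; rewrite addn0 cell_put !eqxx.
Qed.

Definition multiply_cost t b k :=
  products_cost t b k t + outputs_cost t b t + 8 ^ t * 4 ^ b + 24 * (t + b) + 40.
Definition multiply_span t b s :=
  products_span t b s t + outputs_span t b t + 24 * (t + b) + 40.

(** The equation on [t] is what the code computes: three halvings give the ceiling of an eighth of
    [t + b]. *)
Lemma multiplies_step feA fzA feB fzB feC fzC fm fpow4 fpow8 fprod fout t b k s :
  onth P feA = Some (eval_body 4 2 tabA feA) ->
  onth P fzA = Some (entries_body feA fzA) ->
  onth P feB = Some (eval_body 4 2 tabB feB) ->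
  onth P fzB = Some (entries_body feB fzB) ->
  onth P feC = Some (eval_body 7 3 tabC feC) ->
  onth P fzC = Some (entries_body feC fzC) ->
  onth P fout = Some (outputs_body fzC fout) ->
  onth P fprod = Some (products_body fzA fzB fm fprod) ->
  onth P fpow4 = Some (pow_body 2 fpow4) ->
  onth P fpow8 = Some (pow_body 3 fpow8) ->
  onth P fm = Some (multiply_body fpow4 fpow8 fprod fout) ->
  0 < t -> (t + b + 7)./2./2./2 = t ->
  multiplies fm b k s ->
  multiplies fm (t + b) (multiply_cost t b k) (multiply_span t b s).
Proof.
move=> HeA HzA HeB HzB HeC HzC Ho Hp H4 H8 Hm t0 et IH.
move=> m bu bv bx ox f g Vu Vv nu nv le_o.
exists (multiply_body fpow4 fpow8 fprod fout) => //.
have lt_u : bu < size m by apply: vec_lt Vu _; rewrite expn_gt0.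
have lt_v : bv < size m by apply: vec_lt Vv _; rewrite expn_gt0.
have lt_x : bx < size m.
  by apply: (@blk_oob _ _ _ ox); apply: leq_trans le_o;
     rewrite -addn1 leq_add2l expn_gt0.
apply: (triple_conv
  (k := 1 + (7 + (8 * b + 2 + 2 + (8 * t + 2 + 2 + (1 + 8 ^ t * 4 ^ b + (1 +
    (products_cost t b k t + 2 + (8 * t + 2 + 2 + (outputs_cost t b t + 2)))))))))
  (s := 1 + (7 + (8 * b + 2 + 2 + (8 * t + 2 + 2 + (1 + (1 +
    (products_span t b s t + 2 + (8 * t + 2 + 2 + (outputs_span t b t + 2)))))))))
  (ps := [::] ++ [::] ++ svp (t + b) f g ++ [::] ++ [::])).
- by rewrite /multiply_cost; clear; lia.
- by rewrite /multiply_span; clear; lia.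
- by rewrite !cats0.
apply: triple_then; [reflexivity | by rewrite -lt0n addn_gt0 t0 |].
apply: (triple_pure (l := [:: _; _; _; _; _; _; _])); first reflexivity.
set r1 := upd _ 7 _.
have [r1_5 r1_6] : r1 5 = Word t /\ r1 6 = Word b.
  by rewrite /r1 /upd /= et addKn.
apply: (triple_call_seq (pow_spec b 1 0 (isT : 0 < 2 <= 3) lt_x H4)) => //.
- by rewrite /= r1_6.
- by rewrite /sub_writes /= !orbT.
move=> ? ? [-> ->] _; rewrite muln1.
apply: (triple_call_seq (pow_spec t (4 ^ b) 0 (isT : 0 < 3 <= 3) lt_x H8)) => //.
- by rewrite /= -[upd r1 _ _ 5]/(r1 5) r1_5.
- by rewrite /sub_writes /= !orbT.
move=> ? ? [-> ->] _.
apply: triple_alloc; first by [].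
set m1 := rcons m _.
have sz1 : size m1 = (size m).+1 by rewrite size_rcons.
apply: (triple_pure (l := [:: _])); first reflexivity.
set r2 := upd _ 11 _.
have old b0 : b0 < size m -> blk m1 b0 = blk m b0 by apply: blk_rcons.
apply: (triple_call_seq (products_spec (ds := [::]) (l := t) (m := m1)
   (bm := size m) (mo := 0) (f := f) (g := g) (bu := bu) (bv := bv)
   HeA HzA HeB HzB Hp IH _ _ _ _ _ _ _)) => //.
- by move=> i lt_i; rewrite /cell old //; apply: Vu.
- by move=> i lt_i; rewrite /cell old //; apply: Vv.
- by rewrite neq_ltn lt_u.
- by rewrite neq_ltn lt_v.
- by rewrite blk_rcons_last size_nseq.
- by rewrite /= -[r2 5]/(r1 5) -[r2 6]/(r1 6) r1_5 r1_6.
- by rewrite sz1.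
- by rewrite sz1.
- by rewrite /sub_reads /= !inE !eqxx orbT.
- by rewrite /sub_writes leqnn.
move=> v3 m3 Hf [K3 _]; have [le3 s3 e3] := K3.
have lt_x3 : bx < size m3 by apply: leq_trans le3; rewrite sz1 ltnW.
apply: (triple_call_seq (pow_spec t (4 ^ b) 0 (isT : 0 < 2 <= 3) lt_x3 H4)) => //.
- by rewrite /= -[upd r2 12 _ 5]/(r1 5) r1_5.
- by apply: leq_trans le3; rewrite sz1.
- by rewrite /sub_writes /= !orbT.
move=> ? ? [-> ->] _; rewrite -expnD.
apply: (triple_call (outputs_spec (ds := [::]) (l := t) (m := m3) (bm := size m)
   (mo := 0) (bo := bx) (oo := ox) HeC HzC Ho _ _ (erefl _)
   (fun z lt_z => filled_holds lt_z Hf) _ _ _)) => //.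
- by rewrite neq_ltn lt_x orbT.
- by apply: leq_trans le3; rewrite sz1.
- have lt_x1 : bx < size m1 by rewrite sz1 ltnW.
  have nx : bx != size m by rewrite neq_ltn lt_x.
  by rewrite (e3 _ lt_x1 nx) old.
- by rewrite /= -[upd _ 13 _ 5]/(r1 5) -[upd _ 13 _ 6]/(r1 6) r1_5 r1_6.
- by apply: leq_trans le3; rewrite sz1.
- by rewrite /sub_reads /= leqnn !orbT.
- by rewrite /sub_writes eqxx !leqnn /= orbT.
move=> v m' HE _ i lt_i.
have [|e [se lt_e ce]] := @code4_surj t (i %/ 4 ^ b).
  by rewrite ltn_divLR ?expn_gt0 // -expnD.
have lt_z : i %% 4 ^ b < 4 ^ b by rewrite ltn_mod expn_gt0.
have ei : i %% 4 ^ b + 4 ^ b * (i %/ 4 ^ b) = i by rewrite addnC mulnC -divn_eq.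
have := filled_ev lt_z se lt_e Hf; rewrite add0n ce ei => Hev.
by have := HE e (i %% 4 ^ b) se lt_e lt_z; rewrite ce cats0 add0n ei Hev.
Qed.
End Multiply.

(** * Solving the recurrences for cost and span *)

Section Bounds.
Local Open Scope nat_scope.

Lemma leq_expl x y n : x <= y -> x ^ n <= y ^ n.
Proof. by case: n => // n; rewrite leq_exp2r. Qed.

(** The factors dominate: 7^t subproblems with 4^b entries each and sums counted as 8^t terms. The
    outputs need only 4^t * 8^t such units per entry; both are rounded up to 64^t. *)
Lemma multiply_cost_le t b k :
  multiply_cost t b k <= 7 ^ t * k + 500 * (64 ^ t * 4 ^ b).
Proof.
rewrite /multiply_cost /products_cost /outputs_cost /entries_cost /eval_cost.
have e78 : 7 ^ t * 8 ^ t <= 64 ^ t by rewrite -expnMn leq_expl.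
have e48 : 4 ^ t * 8 ^ t <= 64 ^ t by rewrite -expnMn leq_expl.
have e8 : 8 ^ t <= 64 ^ t by rewrite leq_expl.
have e7 : 7 ^ t <= 64 ^ t by rewrite leq_expl.
have e4 : 4 ^ t <= 64 ^ t by rewrite leq_expl.
have et : t < 64 ^ t by apply: ltn_expl.
have eb : b < 4 ^ b by apply: ltn_expl.
have p8 : 0 < 8 ^ t by rewrite expn_gt0.
have p7 : 0 < 7 ^ t by rewrite expn_gt0.
have p4 : 0 < 4 ^ t by rewrite expn_gt0.
move: e78 e48 e8 e7 e4 et eb p8 p7 p4.
move: (8 ^ t) (7 ^ t) (4 ^ t) (64 ^ t) (4 ^ b) => x y z w u.
move=> e78 e48 e8 e7 e4 et eb p8 p7 p4.
have h1 : y * x * u <= w * u by rewrite leq_mul2r e78 orbT.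
have h2 : z * x * u <= w * u by rewrite leq_mul2r e48 orbT.
have h3 : y * u <= w * u by rewrite leq_mul2r e7 orbT.
have h4 : z * u <= w * u by rewrite leq_mul2r e4 orbT.
have h5 : x * u <= w * u by rewrite leq_mul2r e8 orbT.
have h6 : w <= w * u by rewrite leq_pmulr //; lia.
have h7 : u <= w * u by rewrite leq_pmull //; lia.
clear -h1 h2 h3 h4 h5 h6 h7 et eb e7 e4 p8 p7 p4.
apply: (@leq_trans (y * (2 * u + 2 * (u * (100 * x + 13)) + k + 18) +
  z * (u * (100 * x + 13) + 14) + x * u + 24 * (t + b) + 40)).
  rewrite !leq_add2r; apply: leq_add; apply: leq_trans (leq_subr _ _) _;
    rewrite leq_mul2l ?leq_add2r ?leq_add2l ?leq_mul2l ?leq_subr ?orbT //.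
by nia.
Qed.

(* [6 ^ b] pays for the stage because [64 * 4 ^ 7 < 7 * 6 ^ 7]: this is where the
   number [t] of levels must be at most about an eighth of [t + b]. *)
Lemma geometric_drop t b : 0 < t -> 7 * t <= b + 7 ->
  500 * 64 * 6 ^ (t + b) + 500 * (64 ^ t * 4 ^ b) <= 7 ^ t * (500 * 64 * 6 ^ b).
Proof.
case: t => // u _ le_b.
have [v ->] : exists v, b = 7 * u + v by exists (b - 7 * u); lia.
have h1 : 4 ^ v <= 6 ^ v by rewrite leq_expl.
(* The inequality 64 * 4^7 <= 7 * 6^7 is split into 8 * 4^6 <= 6^6, the cube of 32 <= 36, and 64 * 4
   <= 8 * 7 * 6, which keeps the numerals small. *)
have h2 : 64 ^ u * 4 ^ (7 * u) <= 7 ^ u * 6 ^ (7 * u).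
  have -> : 7 * u = 2 * (3 * u) + u by lia.
  rewrite (expnD 4 (2 * _)) (expnD 6 (2 * _)) (expnM 4 2) (expnM 6 2).
  have a1 : 32 ^ (3 * u) <= (6 ^ 2) ^ (3 * u) by rewrite leq_expl.
  have a2 : 32 ^ (3 * u) = 8 ^ u * (4 ^ 2) ^ (3 * u).
    by rewrite -[32]/(2 * 4 ^ 2) expnMn (expnM 2 3).
  have a3 : 64 ^ u * 4 ^ u <= 8 ^ u * 7 ^ u * 6 ^ u by rewrite -!expnMn leq_expl.
  move: a1; rewrite a2 mulnCA; move: a3 => /(leq_mul (leqnn ((4 ^ 2) ^ (3 * u)))) a3 a1.
  apply: (leq_trans a3).
  have -> : (4 ^ 2) ^ (3 * u) * (8 ^ u * 7 ^ u * 6 ^ u) =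
    7 ^ u * (8 ^ u * (4 ^ 2) ^ (3 * u) * 6 ^ u) by lia.
  by rewrite leq_mul2l leq_mul2r a1 !orbT.
have h3 : 64 ^ u * (4 ^ (7 * u) * 4 ^ v) <= 7 ^ u * (6 ^ (7 * u) * 6 ^ v).
  by rewrite !mulnA leq_mul.
have h4 : 6 ^ u <= 7 ^ u by rewrite leq_expl.
rewrite addSn (expnS 6) (expnS 64) (expnS 7) (expnD 6 u) (expnD 6 (7 * u))
  (expnD 4 (7 * u)); move: h3 h4.
move: (4 ^ (7 * u)) (4 ^ v) (6 ^ (7 * u)) (6 ^ v) (64 ^ u) (7 ^ u) (6 ^ u).
move=> a b1 c d x y z; clear => h3 h4.
have {h4} : z * (c * d) <= y * (c * d) by rewrite leq_mul2r h4 orbT.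
have -> : 500 * (64 * x * (a * b1)) = 500 * 64 * (x * (a * b1)) by rewrite !mulnA.
have -> : 7 * y * (500 * 64 * (c * d)) = 500 * 64 * (7 * (y * (c * d))).
  by rewrite mulnCA (mulnA 7).
(* In units of 500 * 64 this is 6 + 1 = 7, with equality for [t = 1], [b = 0]; hence this factor in
   front of 6^a. *)
move: h3; move: (x * _) (y * _) (z * _) => h1 h2 h3; clear; lia.
Qed.

Variables (R : nzRingType) (P : program).

Lemma multiplies_all feA fzA feB fzB feC fzC fm fpow4 fpow8 fprod fout c :
  onth P feA = Some (eval_body 4 2 tabA feA) ->
  onth P fzA = Some (entries_body feA fzA) ->
  onth P feB = Some (eval_body 4 2 tabB feB) ->
  onth P fzB = Some (entries_body feB fzB) ->
  onth P feC = Some (eval_body 7 3 tabC feC) ->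
  onth P fzC = Some (entries_body feC fzC) ->
  onth P fout = Some (outputs_body fzC fout) ->
  onth P fprod = Some (products_body fzA fzB fm fprod) ->
  onth P fpow4 = Some (pow_body 2 fpow4) ->
  onth P fpow8 = Some (pow_body 3 fpow8) ->
  onth P fm = Some (multiply_body fpow4 fpow8 fprod fout) ->
  exists k s, [/\ multiplies R P fm c k s, k + 500 * 64 * 6 ^ c <= (500 * 64 + 5) * 7 ^ c &
    s <= 1400 * c.+1].
Proof.
move=> HeA HzA HeB HzB HeC HzC Ho Hp H4 H8 Hm.
elim/ltn_ind: c => c IH; have [->|c0] := posnP c.
  (* The cost 5 of a scalar product makes the bound an equality at [c = 0]; hence the constant 500 *
     64 + 5. *)
  exists 5, 5; split; [exact: multiplies0 Hm | | by []].
  by rewrite !expn0 !muln1 addnC leqnn.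
(* [8 * t] lies between [c] and [c + 7]. The upper estimate controls the cost of the stage, the
   lower one its span. *)
have [t [b [t0 ec et le_b ge_b]]] : exists t b, [/\ 0 < t, c = t + b,
    (c + 7)./2./2./2 = t, 7 * t <= b + 7 & b <= 7 * t].
  by exists (c + 7)./2./2./2, (c - (c + 7)./2./2./2); split; lia.
have [|k [s [Hk lek les]]] := IH b; first by rewrite ec -[b in b < _]add0n ltn_add2r.
rewrite ec in et *; exists (multiply_cost t b k), (multiply_span t b s); split.
- exact: (multiplies_step HeA HzA HeB HzB HeC HzC Ho Hp H4 H8 Hm).
- have h1 := multiply_cost_le t b k; have h2 := geometric_drop t0 le_b.
  have h3 : 7 ^ t * k + 7 ^ t * (500 * 64 * 6 ^ b) <= (500 * 64 + 5) * 7 ^ (t + b).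
    by rewrite -mulnDr (expnD 7) [(_ + 5) * _]mulnCA leq_mul2l lek orbT.
  move: h1 h2 h3; move: (multiply_cost _ _ _) (7 ^ t * k) (7 ^ t * (500 * 64 * _))
    (500 * (64 ^ _ * _)) (500 * 64 * 6 ^ (t + b)) (_ * 7 ^ (t + b)).
  by clear; lia.
(* The stage adds 381 * t + 81 * b + 361 to the span, at most 1309 * t as [b <= 7 * t] and [t > 0];
   the induction leaves room for 1400 * t. *)
- rewrite /multiply_span /products_span /outputs_span /entries_span /eval_span.
  by move: les ge_b t0; clear; lia.
Qed.
End Bounds.

(** * Conversion of the layouts, and the main procedure *)

(* Registers: 0 = [c], 1 = [4 ^ c], 2 = row stride times [2 ^ c], 3 = [2 ^ c],
   4 = source, 5 = output.  The source offsets of the quadrants are not in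
   arithmetic progression: the increments [11] and [12] are swapped at each step. *)
Definition load_advance : seq instr :=
  [:: Bin Plus 4 4 11; Bin Plus 5 5 8; Un Copy 13 11; Un Copy 11 12; Un Copy 12 13].

Definition load_body (self : nat) : com :=
  If 0
    (prefix_com [:: Const 6 1; Bin Minus 7 0 6; Un Half 8 1; Un Half 8 8;
        Un Half 9 2; Un Half 10 3; Un Copy 11 10; Bin Minus 12 9 10]
      (par 3 load_advance (Call 14 self [:: 7; 8; 9; 10; 4; 5])))
    (Defs.Seq (Do (Read 6 4)) (Do (Write 5 6))).

(* Registers: 0 = [c], 1 = [4 ^ c], 2 = [2 ^ c], 3 = source, 4 = output. *)
Definition store_row_body (self : nat) : com :=
  If 0
    (prefix_com [:: Const 5 1; Bin Minus 6 0 5; Un Half 7 1; Un Half 7 7; Un Half 8 2]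
      (par 1 [:: Bin Plus 3 3 7; Bin Plus 4 4 8] (Call 9 self [:: 6; 7; 8; 3; 4])))
    (Defs.Seq (Do (Read 5 3)) (Do (Write 4 5))).

(* Registers: 0 = [c], 1 = [2 * 4 ^ c], 2 = row length times [2 ^ c], 3 = source,
   4 = output, 5-7 = arguments 0-2 of [store_row_body]. *)
Definition store_body (frow self : nat) : com :=
  If 0
    (prefix_com [:: Const 8 1; Bin Minus 9 0 8; Un Half 10 1; Un Half 10 10; Un Half 11 2]
      (par 1 [:: Bin Plus 3 3 10; Bin Plus 4 4 11]
        (Call 12 self [:: 9; 10; 11; 3; 4; 5; 6; 7])))
    (Call 12 frow [:: 5; 6; 7; 3; 4]).

Definition log_body (self : nat) : com :=
  prefix_com [:: Un Half 1 0]
    (If 1 (Defs.Seq (Call 2 self [:: 1]) (prefix_com [:: Const 3 1] (Do (Bin Plus 0 2 3))))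
       (Do (Const 0 0))).

(** Registers: 0 = n, 1, 2 = inputs, 3 = output, 4 = log n, 6 = n^2, 7, 8 = factors and 9 = product
    in the recursive layout, 11 = 2 * n^2. *)
Definition main_body (flog fpow4 fload fmul fstore : nat) : com :=
  Defs.Seq (Call 4 flog [:: 0]) (prefix_com [:: Const 5 1]
    (Defs.Seq (Call 6 fpow4 [:: 4; 5])
      (Defs.Seq (Do (Alloc 7 6)) (Defs.Seq (Do (Alloc 8 6)) (Defs.Seq (Do (Alloc 9 6))
        (Defs.Seq (Call 10 fload [:: 4; 6; 6; 0; 1; 7])
          (Defs.Seq (Call 10 fload [:: 4; 6; 6; 0; 2; 8])
            (Defs.Seq (Call 10 fmul [:: 4; 7; 8; 9])
              (prefix_com [:: Bin Plus 11 6 6]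
                (Call 10 fstore [:: 4; 11; 6; 9; 3; 4; 6; 0])))))))))).

(** * Correctness of the layout conversions *)

Section Layout.
Local Open Scope nat_scope.

(* The offset, in a row-major matrix with rows of length [n], of the entry [o] of
   the recursive layout of a block of size [2 ^ c]. *)
Fixpoint row_major_index n c o : nat :=
  if c is c'.+1 then
    (o %/ 4 ^ c')./2 * (2 ^ c' * n) + odd (o %/ 4 ^ c') * 2 ^ c' +
    row_major_index n c' (o %% 4 ^ c')
  else 0.

(* The bits of [i], read in base 4. *)
Fixpoint spread c i : nat :=
  if c is c'.+1 then i %/ 2 ^ c' * 4 ^ c' + spread c' (i %% 2 ^ c') else 0.

Lemma expn2_half c n : (2 ^ c.+1 * n)./2 = 2 ^ c * n.
Proof. by rewrite expnS; lia. Qed.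

Variables (R : nzRingType) (P : program).
Implicit Types (r : regs R) (m : memory R) (x : nat -> R).

(** The two increments alternate, [d1] first: one leads to the right neighbour, the other back to
    the left and down. *)
Lemma iter_load_advance r b o b' o' h d1 d2 q :
  r 4 = Ptr b o -> r 5 = Ptr b' o' -> r 8 = Word h -> r 11 = Word d1 -> r 12 = Word d2 ->
  let r' := iter q (advance load_advance) r in
  [/\ pure_run load_advance r' : bool,
      r' 4 = Ptr b (o + uphalf q * d1 + q./2 * d2), r' 5 = Ptr b' (o' + q * h),
      r' 11 = Word (if odd q then d2 else d1) /\ r' 12 = Word (if odd q then d1 else d2) &
      forall z, 5 < z < 11 -> r' z = r z].
Proof.
move=> r4 r5 r8 r11 r12.
have run (r0 : regs R) o0 o0' e1 e2 : r0 4 = Ptr b o0 -> r0 5 = Ptr b' o0' ->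
    r0 8 = Word h -> r0 11 = Word e1 -> r0 12 = Word e2 ->
    pure_run load_advance r0 = Some (upd (upd (upd (upd (upd r0 4 (Ptr b (o0 + e1)))
      5 (Ptr b' (o0' + h))) 13 (Word e1)) 11 (Word e2)) 12 (Word e1)).
  by move=> e4 e5 e8 e11 e12; rewrite /= /upd /= e4 e11 /= e5 e8 /= e11 e12.
elim: q => [|q IH] r'.
  have -> : r' = r by [].
  split=> //; first by rewrite (run r o o' d1 d2).
    by rewrite r4 !mul0n !addn0.
  by rewrite r5 mul0n addn0.
have [_ I4 I5 [I11 I12] Iz] := IH.
have I8 : iter q (advance load_advance) r 8 = Word h by rewrite Iz.
have advE r0 r1 : pure_run load_advance r0 = Some r1 -> advance load_advance r0 = r1.
  by rewrite /advance => ->.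
rewrite {}/r' iterS (advE _ _ (run _ _ _ _ _ I4 I5 I8 I11 I12)).
split.
- by rewrite (run _ _ _ _ _ (erefl _) (erefl _) I8 (erefl _) (erefl _)).
- rewrite /upd /=; congr Ptr; rewrite uphalf_half; move: q./2 => u.
  by clear; case: (odd q); lia.
- by rewrite /upd /=; congr Ptr; lia.
- by rewrite /upd /=; case: (odd q).
- move=> z Hz; rewrite /upd; do 5?[case: eqP => [?|_]; first by subst; lia].
  exact: Iz.
Qed.

Lemma load_spec fl n c so bs bo oo m x :
  onth P fl = Some (load_body fl) -> 0 < n ->
  (forall o, o < 4 ^ c -> cell m bs (so + row_major_index n c o) =
     Scal (x (so + row_major_index n c o))) ->
  bs != bo -> oo + 4 ^ c <= size (blk m bo) ->
  proc P fl [:: Word c; Word (4 ^ c); Word (2 ^ c * n); Word (2 ^ c); Ptr bs so; Ptr bo oo]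
    m [:: bs] bo oo (4 ^ c) (40 * 4 ^ c - 20) (40 * c + 3) [::]
    (fun _ m' => forall o, o < 4 ^ c ->
       cell m' bo (oo + o) = Scal (x (so + row_major_index n c o))).
Proof.
move=> Hl n0; elim: c so oo m => [|c IH] so oo m Hx nbs le_oo;
  exists (load_body fl) => //.
  have lt_oo : oo < size (blk m bo) by rewrite addn1 in le_oo.
  apply: (triple_conv (k := 1 + (1 + 1)) (s := 1 + (1 + 1)) (ps := [::])) => //.
  apply: triple_else; first by [].
  apply: triple_read; [reflexivity | by rewrite inE eqxx | | | ].
  - by have := Hx 0 isT; rewrite addn0; apply.
  - by [].
  apply: triple_write; [reflexivity | | by [] |].
    by rewrite eqxx /within leqnn addn1 leqnn.
  move=> o; rewrite ltnS leqn0 => /eqP->; rewrite addn0 cell_put !eqxx /upd /=.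
  by rewrite !addn0.
have lt_s : bs < size m.
  have c0 : 0 < 4 ^ c.+1 by rewrite expn_gt0.
  exact: cell_lt (Hx 0 c0).
have lt_bo : bo < size m.
  apply: (@blk_oob _ _ _ oo); apply: leq_trans le_oo.
  by rewrite -addn1 leq_add2l expn_gt0.
apply: (triple_conv
  (k := 1 + (8 + 4 * (40 * 4 ^ c - 20 + 4 + 5)))
  (s := 1 + (8 + (40 * c + 3 + 2 + 3 * (2 + 5))))
  (ps := flatten [seq [::] | q <- iota 0 4])) => //.
- rewrite expnS; have : 0 < 4 ^ c by rewrite expn_gt0.
  by move: (4 ^ c) => y; clear; lia.
- by clear; lia.
apply: triple_then; [reflexivity | by [] |].
apply: (triple_pure (l := [:: _; _; _; _; _; _; _; _])); first reflexivity.
set r1 := upd _ 12 _.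
have e2 : (2 ^ c.+1)./2 = 2 ^ c by rewrite -[2 ^ c.+1]muln1 expn2_half muln1.
have [r1_4 r1_5 r1_8 r1_11 r1_12] : [/\ r1 4 = Ptr bs so, r1 5 = Ptr bo oo,
    r1 8 = Word (4 ^ c), r1 11 = Word (2 ^ c) & r1 12 = Word (2 ^ c * n - 2 ^ c)].
  by rewrite /r1 /upd /= expn4_half expn2_half e2.
have adv q := iter_load_advance q r1_4 r1_5 r1_8 r1_11 r1_12.
apply: triple_post; first apply: (triple_par (args := fun q => [:: Word c; Word (4 ^ c);
     Word (2 ^ c * n); Word (2 ^ c); Ptr bs (so + (q./2 * (2 ^ c * n) + odd q * 2 ^ c));
     Ptr bo (oo + q * 4 ^ c)])
    (rb' := [:: bs]) (wb' := bo) (lo' := oo) (h := 4 ^ c)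
    (Q := fun q m' => forall o, o < 4 ^ c ->
       cell m' bo (oo + q * 4 ^ c + o) =
       Scal (x (so + (q./2 * (2 ^ c * n) + odd q * 2 ^ c) + row_major_index n c o)))
    (ps := fun=> [::])) => //.
- by move=> q _; have [] := adv q.
- move=> q le_q; have [_ a4 a5 _ az] := adv q.
  rewrite /= a4 a5 !az // /r1 /upd /= expn4_half expn2_half e2 subn1 /=.
  (* As [n > 0], the truncated difference in register 12 is exact. *)
  have le_n : 2 ^ c <= 2 ^ c * n by rewrite leq_pmulr.
  congr [:: _; _; _; _; Ptr _ _; _]; rewrite -addnA; congr (_ + _).
  move: le_q le_n; move: (2 ^ c) (_ * n) => u w; clear => le_q le_n.
  by move: q le_q; do 4?[case=> //=]; rewrite ?mul0n ?mul1n ?addn0; lia.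
- by rewrite inE eq_sym.
- by rewrite /= lt_s.
- by rewrite /sub_reads /= inE eqxx.
- by rewrite /sub_writes eqxx !leqnn expnS /= leqnn orbT.
- move=> q ma mb E Hq j lt_j; rewrite E ?Hq //.
  by rewrite /within leq_addr ltn_add2l.
- move=> q m' le_q K'; have [le_m' s2 e3] := K'.
  apply: IH => //.
  + move=> o lt_o; rewrite /cell e3 //.
    have := Hx (q * 4 ^ c + o); rewrite /= divnMDl ?expn_gt0 // divn_small //.
    rewrite modnMDl modn_small // addn0 !addnA; apply; rewrite expnS.
    by move: lt_o le_q; clear; nia.
  + rewrite s2; apply: leq_trans le_oo; rewrite expnS -addnA leq_add2l.
    by move: le_q; clear; nia.
move=> r' m' [_ Hq _] o lt_o.
have lt_q : o %/ 4 ^ c < 4 by rewrite ltn_divLR ?expn_gt0 // -expnS.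
have lt_r : o %% 4 ^ c < 4 ^ c by rewrite ltn_mod expn_gt0.
have := Hq _ (lt_q : _ <= 3) _ lt_r; rewrite -(addnA oo) -divn_eq => ->.
by rewrite /= !addnA.
Qed.

Lemma store_row_spec fs c so bs bo oo m x :
  onth P fs = Some (store_row_body fs) ->
  (forall j, j < 2 ^ c -> cell m bs (so + spread c j) = Scal (x (so + spread c j))) ->
  bs != bo -> oo + 2 ^ c <= size (blk m bo) ->
  proc P fs [:: Word c; Word (4 ^ c); Word (2 ^ c); Ptr bs so; Ptr bo oo]
    m [:: bs] bo oo (2 ^ c) (40 * 2 ^ c - 30) (40 * c + 3) [::]
    (fun _ m' => forall j, j < 2 ^ c ->
       cell m' bo (oo + j) = Scal (x (so + spread c j))).
Proof.
move=> Hl; elim: c so oo m => [|c IH] so oo m Hx nbs le_oo;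
  exists (store_row_body fs) => //.
  have lt_oo : oo < size (blk m bo) by rewrite addn1 in le_oo.
  apply: (triple_conv (k := 1 + (1 + 1)) (s := 1 + (1 + 1)) (ps := [::])) => //.
  apply: triple_else; first by [].
  apply: triple_read; [reflexivity | by rewrite inE eqxx | | | ].
  - by have := Hx 0 isT; rewrite addn0; apply.
  - by [].
  apply: triple_write; [reflexivity | | by [] |].
    by rewrite eqxx /within leqnn addn1 leqnn.
  move=> o; rewrite ltnS leqn0 => /eqP->; rewrite addn0 cell_put !eqxx /upd /=.
  by rewrite !addn0.
have lt_s : bs < size m.
  have c0 : 0 < 2 ^ c.+1 by rewrite expn_gt0.
  exact: cell_lt (Hx 0 c0).
have lt_bo : bo < size m.
  apply: (@blk_oob _ _ _ oo); apply: leq_trans le_oo.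
  by rewrite -addn1 leq_add2l expn_gt0.
apply: (triple_conv
  (k := 1 + (5 + 2 * (40 * 2 ^ c - 30 + 4 + 2)))
  (s := 1 + (5 + (40 * c + 3 + 2 + 1 * (2 + 2))))
  (ps := flatten [seq [::] | q <- iota 0 2])) => //.
- rewrite expnS; have : 0 < 2 ^ c by rewrite expn_gt0.
  by move: (2 ^ c) => y; clear; lia.
- by clear; lia.
apply: triple_then; [reflexivity | by [] |].
apply: (triple_pure (l := [:: _; _; _; _; _])); first reflexivity.
set r1 := upd _ 8 _.
have e2 : (2 ^ c.+1)./2 = 2 ^ c by rewrite -[2 ^ c.+1]muln1 expn2_half muln1.
have [r1_3 r1_4 r1_7 r1_8] : [/\ r1 3 = Ptr bs so, r1 4 = Ptr bo oo,
    r1 7 = Word (4 ^ c) & r1 8 = Word (2 ^ c)].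
  by rewrite /r1 /upd /= expn4_half e2.
have adv q := @iter_advance _ 3 7 4 8 r1 _ _ q r1_7 r1_8.
rewrite r1_3 r1_4 in adv.
have {}adv q := adv q isT isT isT isT.
apply: triple_post; first apply: (triple_par (args := fun q => [:: Word c; Word (4 ^ c);
     Word (2 ^ c); Ptr bs (so + q * 4 ^ c); Ptr bo (oo + q * 2 ^ c)])
    (rb' := [:: bs]) (wb' := bo) (lo' := oo) (h := 2 ^ c)
    (Q := fun q m' => forall j, j < 2 ^ c ->
       cell m' bo (oo + q * 2 ^ c + j) = Scal (x (so + q * 4 ^ c + spread c j)))
    (ps := fun=> [::])) => //.
- by move=> q _; have [-> _] := adv q.
- move=> q le_q; have [_ E] := adv q.
  by rewrite /= !E /= /r1 /upd /= expn4_half e2 subn1.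
- by rewrite inE eq_sym.
- by rewrite /= lt_s.
- by rewrite /sub_reads /= inE eqxx.
- by rewrite /sub_writes eqxx !leqnn expnS /= leqnn orbT.
- move=> q ma mb E Hq j lt_j; rewrite E ?Hq //.
  by rewrite /within leq_addr ltn_add2l.
- move=> q m' le_q K'; have [le_m' s2 e3] := K'.
  apply: IH => //.
  + move=> o lt_o; rewrite /cell e3 //.
    have := Hx (q * 2 ^ c + o); rewrite /= divnMDl ?expn_gt0 // divn_small //.
    rewrite modnMDl modn_small // addn0 !addnA; apply; rewrite expnS.
    by move: lt_o le_q; clear; nia.
  + rewrite s2; apply: leq_trans le_oo; rewrite expnS -addnA leq_add2l.
    by move: le_q; clear; nia.
move=> r' m' [_ Hq _] o lt_o.
have lt_q : o %/ 2 ^ c < 2 by rewrite ltn_divLR ?expn_gt0 // -expnS.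
have lt_r : o %% 2 ^ c < 2 ^ c by rewrite ltn_mod expn_gt0.
have := Hq _ (lt_q : _ <= 1) _ lt_r; rewrite -(addnA oo) -divn_eq => ->.
by rewrite /= !addnA.
Qed.

(** A quadrant of a row-major matrix is not an interval, but footprints are. So the output is
    traversed in its own order, halving the range of rows and then each row, and the scattered
    accesses are the reads. *)
Lemma store_spec fr fs k c so bs bo oo m x :
  onth P fr = Some (store_row_body fr) ->
  onth P fs = Some (store_body fr fs) ->
  (forall i j, i < 2 ^ c -> j < 2 ^ k ->
     cell m bs (so + 2 * spread c i + spread k j) =
     Scal (x (so + 2 * spread c i + spread k j))) ->
  bs != bo -> oo + 2 ^ c * 2 ^ k <= size (blk m bo) ->
  proc P fs [:: Word c; Word (2 * 4 ^ c); Word (2 ^ c * 2 ^ k); Ptr bs so; Ptr bo oo;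
      Word k; Word (4 ^ k); Word (2 ^ k)]
    m [:: bs] bo oo (2 ^ c * 2 ^ k) (40 * (2 ^ c * 2 ^ k) - 20) (40 * (c + k) + 6) [::]
    (fun _ m' => forall i j, i < 2 ^ c -> j < 2 ^ k ->
       cell m' bo (oo + i * 2 ^ k + j) = Scal (x (so + 2 * spread c i + spread k j))).
Proof.
move=> Hr Hl; elim: c so oo m => [|c IH] so oo m Hx nbs le_oo;
  exists (store_body fr fs) => //.
all: have pow2_gt0 i : 0 < 2 ^ i by rewrite expn_gt0.
all: have lt_s := cell_lt (Hx 0 0 (pow2_gt0 _) (pow2_gt0 _)).
all: have lt_bo : bo < size m
  by apply: (@blk_oob _ _ _ oo); apply: leq_trans le_oo;
     rewrite -addn1 leq_add2l muln_gt0 !expn_gt0.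
  rewrite expn0 mul1n in le_oo *.
  apply: (triple_conv (k := 1 + (40 * 2 ^ k - 30 + 2)) (s := 1 + (40 * k + 3 + 2))
    (ps := [::])) => //.
  - by have : 0 < 2 ^ k; [rewrite expn_gt0 | clear; lia].
  - by clear; lia.
  apply: triple_else; first by [].
  apply: (triple_call (store_row_spec (c := k) (so := so) (x := x) Hr _ nbs le_oo)) => //.
  - by move=> j lt_j; have := Hx 0 j isT lt_j; rewrite /= muln0 addn0.
  - by rewrite /sub_reads /= inE eqxx.
  - by rewrite /sub_writes eqxx !leqnn /= orbT.
  move=> v m' E _ i j; rewrite ltnS leqn0 => /eqP-> lt_j.
  by rewrite mul0n muln0 !addn0 E.
apply: (triple_conv
  (k := 1 + (5 + 2 * (40 * (2 ^ c * 2 ^ k) - 20 + 4 + 2)))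
  (s := 1 + (5 + (40 * (c + k) + 6 + 2 + 1 * (2 + 2))))
  (ps := flatten [seq [::] | q <- iota 0 2])) => //.
- rewrite expnS -mulnA; have : 0 < 2 ^ c * 2 ^ k by rewrite muln_gt0 !expn_gt0.
  by move: (_ * 2 ^ k) => y; clear; lia.
- by clear; lia.
apply: triple_then; [reflexivity | by [] |].
apply: (triple_pure (l := [:: _; _; _; _; _])); first reflexivity.
set r1 := upd _ 11 _.
have e4 : (2 * 4 ^ c.+1)./2./2 = 2 * 4 ^ c by rewrite expnS; lia.
have [r1_3 r1_4 r1_10 r1_11] : [/\ r1 3 = Ptr bs so, r1 4 = Ptr bo oo,
    r1 10 = Word (2 * 4 ^ c) & r1 11 = Word (2 ^ c * 2 ^ k)].
  by rewrite /r1 /upd /= e4 expn2_half.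
have adv q := @iter_advance _ 3 10 4 11 r1 _ _ q r1_10 r1_11.
rewrite r1_3 r1_4 in adv.
have {}adv q := adv q isT isT isT isT.
apply: triple_post; first apply: (triple_par (args := fun q => [:: Word c;
     Word (2 * 4 ^ c); Word (2 ^ c * 2 ^ k); Ptr bs (so + q * (2 * 4 ^ c));
     Ptr bo (oo + q * (2 ^ c * 2 ^ k)); Word k; Word (4 ^ k); Word (2 ^ k)])
    (rb' := [:: bs]) (wb' := bo) (lo' := oo) (h := 2 ^ c * 2 ^ k)
    (Q := fun q m' => forall i j, i < 2 ^ c -> j < 2 ^ k ->
       cell m' bo (oo + q * (2 ^ c * 2 ^ k) + i * 2 ^ k + j) =
       Scal (x (so + q * (2 * 4 ^ c) + 2 * spread c i + spread k j)))
    (ps := fun=> [::])) => //.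
- by move=> q _; have [-> _] := adv q.
- move=> q le_q; have [_ E] := adv q.
  by rewrite /= !E /= /r1 /upd /= e4 expn2_half subn1.
- by rewrite inE eq_sym.
- by rewrite /= lt_s.
- by rewrite /sub_reads /= inE eqxx.
- by rewrite /sub_writes eqxx !leqnn expnS -mulnA /= leqnn orbT.
- move=> q ma mb E Hq i j lt_i lt_j; rewrite E ?Hq //.
  by rewrite /within -!addnA leq_add2l leq_addr !ltn_add2l; move: lt_i lt_j; clear; nia.
- move=> q m' le_q K'; have [le_m' s2 e3] := K'.
  apply: IH => //.
  + move=> i j lt_i lt_j; rewrite /cell e3 //.
    have := Hx (q * 2 ^ c + i) j; rewrite /= divnMDl ?expn_gt0 // divn_small //.
    rewrite modnMDl modn_small // addn0 mulnDr [2 * (q * _)]mulnCA !addnA; apply=> //.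
    by rewrite expnS; move: lt_i le_q; clear; nia.
  + rewrite s2; apply: leq_trans le_oo; rewrite expnS -addnA leq_add2l -mulnA.
    by move: le_q (2 ^ c * 2 ^ k); clear; nia.
move=> r' m' [_ Hq _] i j lt_i lt_j.
have lt_q : i %/ 2 ^ c < 2 by rewrite ltn_divLR ?expn_gt0 // -expnS.
have lt_r : i %% 2 ^ c < 2 ^ c by rewrite ltn_mod expn_gt0.
have := Hq _ (lt_q : _ <= 1) _ _ lt_r lt_j.
rewrite -(addnA oo) mulnA -mulnDl -divn_eq => ->; congr (Scal (x _)).
by rewrite /= mulnDr [2 * (_ * _)]mulnCA !addnA.
Qed.

Lemma log_spec fl k m wb lo : wb < size m ->
  onth P fl = Some (log_body fl) ->
  proc P fl [:: Word (2 ^ k)] m [::] wb lo 0 (8 * k + 3) (8 * k + 3) [::]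
    (fun v m' => v = Word k /\ m' = m).
Proof.
move=> lt_w Hl; elim: k => [|k IH]; exists (log_body fl) => //.
  apply: (triple_conv (k := 1 + (1 + 1)) (s := 1 + (1 + 1)) (ps := [::])) => //.
  apply: (triple_pure (l := [:: _])); first reflexivity.
  apply: triple_else; first by [].
  by apply: triple_do_pure; first reflexivity.
apply: (triple_conv (k := 1 + (1 + (8 * k + 3 + 2 + (1 + 1))))
  (s := 1 + (1 + (8 * k + 3 + 2 + (1 + 1)))) (ps := [::] ++ [::])) => //; try lia.
apply: (triple_pure (l := [:: _])); first reflexivity.
have e2 : (2 ^ k.+1)./2 = 2 ^ k by rewrite -[2 ^ k.+1]muln1 expn2_half muln1.
apply: triple_then; [reflexivity | by rewrite e2 -lt0n expn_gt0 |].
apply: (triple_call_seq IH) => //.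
- by rewrite /= e2.
- by rewrite /sub_writes /= !orbT.
move=> v m' [-> ->] _.
apply: (triple_pure (l := [:: _])); first reflexivity.
by apply: triple_do_pure; [reflexivity | rewrite /upd /= addn1].
Qed.
End Layout.

(** * Index arithmetic of the two layouts *)

Section Indices.
Local Open Scope nat_scope.

Lemma nth_allpairs (S T V : Type) (h : S -> T -> V) (v0 : V) (s0 : S) (t0 : T)
    (s : seq S) (t : seq T) i j :
  i < size s -> j < size t ->
  nth v0 [seq h a b | a <- s, b <- t] (i * size t + j) = h (nth s0 s i) (nth t0 t j).
Proof.
elim: s i => // a s IH [|i] lt_i lt_j; rewrite allpairs_cons nth_cat size_map.
  by rewrite mul0n add0n lt_j (nth_map t0).
by rewrite mulSn -addnA ltnNge leq_addr /= addKn IH.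
Qed.

(** A base-4 numeral with digits 0 and 1 is at most (4^c - 1) / 3; the factor 3 leaves room for
    [2 * spread c i + spread c j]. *)
Lemma spread_lt c i : i < 2 ^ c -> 3 * spread c i < 4 ^ c.
Proof.
elim: c i => [|c IH] i //=; rewrite !expnS => lt_i.
have /IH : i %% 2 ^ c < 2 ^ c by rewrite ltn_mod expn_gt0.
have : i %/ 2 ^ c < 2 by rewrite ltn_divLR ?expn_gt0.
move: (i %/ _) (spread _ _) (4 ^ c) => q x y; clear => lt_q lt_x.
have : q * y <= 1 * y by rewrite leq_mul2r -ltnS lt_q orbT.
by lia.
Qed.

Lemma spread2_lt c i j : i < 2 ^ c -> j < 2 ^ c -> 2 * spread c i + spread c j < 4 ^ c.
Proof. by move=> /spread_lt hi /spread_lt hj; lia. Qed.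

Lemma spreadD c (q : bool) i : i < 2 ^ c ->
  spread c.+1 (q * 2 ^ c + i) = q * 4 ^ c + spread c i.
Proof.
by move=> lt_i; rewrite /= divnMDl ?expn_gt0 // divn_small // addn0 modnMDl modn_small.
Qed.

Lemma row_major_indexD n c (a b : bool) o : o < 4 ^ c ->
  row_major_index n c.+1 ((2 * a + b) * 4 ^ c + o) =
  a * (2 ^ c * n) + b * 2 ^ c + row_major_index n c o.
Proof.
move=> lt_o /=.
rewrite divnMDl ?expn_gt0 // divn_small // addn0 modnMDl modn_small //.
by case: a; case: b.
Qed.

Lemma bit_split c i : i < 2 ^ c.+1 ->
  exists (q : bool) i', i' < 2 ^ c /\ i = q * 2 ^ c + i'.
Proof.
rewrite expnS => lt_i; have [lt|ge] := ltnP i (2 ^ c); first by exists false, i.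
exists true, (i - 2 ^ c); rewrite mul1n subnKC //; split=> //.
by move: lt_i ge; clear; lia.
Qed.

(** The recursive layout is the Morton order: the offset of an entry interleaves the bits of its row
    and column. *)
Lemma row_major_index_spread n c i j : i < 2 ^ c -> j < 2 ^ c ->
  row_major_index n c (2 * spread c i + spread c j) = i * n + j.
Proof.
elim: c i j => [|c IH] i j; first by rewrite !ltnS !leqn0 => /eqP-> /eqP->.
move=> /bit_split[a [i' [lt_i ->]]] /bit_split[b [j' [lt_j ->]]].
rewrite !spreadD // (_ : 2 * _ + _ = (2 * a + b) * 4 ^ c + (2 * spread c i' + spread c j')).
  by rewrite row_major_indexD ?spread2_lt // IH // mulnDl mulnA; clear; lia.
by clear; lia.
Qed.

Lemma row_major_index_lt k o : o < 4 ^ k -> row_major_index (2 ^ k) k o < 2 ^ k * 2 ^ k.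
Proof.
(* The row length stays [2 ^ k] while the block size varies in the induction. *)
have H c : forall o, exists i j, [/\ i < 2 ^ c, j < 2 ^ c &
    o < 4 ^ c -> row_major_index (2 ^ k) c o = i * 2 ^ k + j].
  elim: c => [|c IH] {}o; first by exists 0, 0.
  have [i [j [lt_i lt_j E]]] := IH (o %% 4 ^ c).
  have c0 : 0 < 2 ^ c by rewrite expn_gt0.
  have [lt_o|ge_o] := ltnP o (4 ^ c.+1); last first.
    exists 0, 0; rewrite !expn_gt0; split=> //.
  have lt_q : o %/ 4 ^ c < 4 by rewrite ltn_divLR ?expn_gt0 // -expnS.
  exists ((o %/ 4 ^ c)./2 * 2 ^ c + i), (odd (o %/ 4 ^ c) * 2 ^ c + j).
  have h1 : (o %/ 4 ^ c)./2 * 2 ^ c <= 1 * 2 ^ c by rewrite leq_mul2r; apply/orP; right; lia.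
  have h2 : odd (o %/ 4 ^ c) * 2 ^ c <= 1 * 2 ^ c by rewrite leq_mul2r leq_b1 orbT.
  rewrite !expnS; split; [by move: h1 lt_i; clear; lia | by move: h2 lt_j; clear; lia |].
  by rewrite /= E ?ltn_mod ?expn_gt0 // mulnDl mulnA; clear; lia.
move=> lt_o; have [i [j [lt_i lt_j ->]]] := H k o => //.
by move: lt_i lt_j; clear; nia.
Qed.

End Indices.

(** * Assembling the conversions and the multiplication *)

Section Main.
Local Open Scope nat_scope.
Variables (R : nzRingType) (P : program).
Implicit Types (m : memory R) (x y : nat -> R).

Lemma main_spec flog fpow4 fload frow fstore fmul k km sm m x y :
  onth P 0 = Some (main_body flog fpow4 fload fmul fstore) ->
  onth P flog = Some (log_body flog) ->
  onth P fpow4 = Some (pow_body 2 fpow4) ->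
  onth P fload = Some (load_body fload) ->
  onth P frow = Some (store_row_body frow) ->
  onth P fstore = Some (store_body frow fstore) ->
  multiplies R P fmul k km sm ->
  size m = 3 -> vec m 0 (2 ^ k * 2 ^ k) x -> vec m 1 (2 ^ k * 2 ^ k) y ->
  size (blk m 2) = 2 ^ k * 2 ^ k ->
  let f := fun o => x (row_major_index (2 ^ k) k o) in
  let g := fun o => y (row_major_index (2 ^ k) k o) in
  proc P 0 [:: Word (2 ^ k); Ptr 0 0; Ptr 1 0; Ptr 2 0] m [:: 0; 1] 2 0 (2 ^ k * 2 ^ k)
    (km + 200 * 4 ^ k) (sm + 200 * k.+1) (svp k f g)
    (fun _ m' => forall i j, i < 2 ^ k -> j < 2 ^ k ->
       cell m' 2 (i * 2 ^ k + j) = Scal (sv k f g (2 * spread k i + spread k j))).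
Proof.
move=> H0 Hlog H4 Hload Hrow Hstore Hmul sz Vx Vy sz2 f g.
have e4 : 4 ^ k = 2 ^ k * 2 ^ k by rewrite -expnMn.
have k0 : 0 < 2 ^ k by rewrite expn_gt0.
exists (main_body flog fpow4 fload fmul fstore) => //.
apply: (triple_conv (k := 8 * k + 3 + 2 + (1 + (8 * k + 2 + 2 + (1 + 4 ^ k +
    (1 + 4 ^ k + (1 + 4 ^ k + (40 * 4 ^ k - 20 + 2 + (40 * 4 ^ k - 20 + 2 + (km + 2 +
      (1 + (40 * (2 ^ k * 2 ^ k) - 20 + 2)))))))))))
  (s := 8 * k + 3 + 2 + (1 + (8 * k + 2 + 2 + (1 + (1 + (1 + (40 * k + 3 + 2 +
     (40 * k + 3 + 2 + (sm + 2 + (1 + (40 * (k + k) + 6 + 2)))))))))))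
  (ps := [::] ++ [::] ++ [::] ++ [::] ++ svp k f g ++ [::])).
- rewrite -e4; have : k < 4 ^ k by apply: ltn_expl.
  by move: (4 ^ k) => u; clear; lia.
- by clear; lia.
- by rewrite cats0.
have lt2 : 2 < size m by rewrite sz.
apply: (triple_call_seq (log_spec k 0 lt2 Hlog)) => //.
  by rewrite /sub_writes /= !orbT.
move=> ? ? [-> ->] _.
apply: (triple_pure (l := [:: _])); first reflexivity.
apply: (triple_call_seq (pow_spec k 1 0 (isT : 0 < 2 <= 3) lt2 H4)) => //.
  by rewrite /sub_writes /= !orbT.
move=> ? ? [-> ->] _; rewrite muln1.
do 3![apply: triple_alloc; first by []].
(* Now blocks 0 and 1 are the inputs, 2 the output, 3 and 4 the factors and 5 the product in the
   recursive layout. *)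
set m1 := rcons (rcons (rcons m _) _) _.
have s1 : size m1 = 6 by rewrite !size_rcons sz.
have old b : b < 3 -> blk m1 b = blk m b.
  rewrite /m1 /blk !nth_rcons !size_rcons sz.
  by move: b; do 3?[case=> //].
have new b : 2 < b < 6 -> size (blk m1 b) = 4 ^ k.
  move=> Hb; rewrite /m1 /blk !nth_rcons !size_rcons sz.
  by move: b Hb; do 6?[case=> //]; rewrite size_nseq.
rewrite !size_rcons sz.
apply: (triple_call_seq (load_spec (n := 2 ^ k) (c := k) (so := 0) (bs := 0) (bo := 3)
   (oo := 0) (m := m1) (x := x) Hload k0 _ _ _)) => //.
- by move=> o lt_o; rewrite /cell old // add0n; apply: Vx; apply: row_major_index_lt.
- by rewrite new.
- by rewrite /= e4.
- by rewrite s1.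
- by rewrite s1.
move=> ? m2 Hx [K2 _]; have [le2 _ keep2] := K2.
have lt_m2 b : b < 6 -> b < size m2 by move=> lt_b; apply: leq_trans le2; rewrite s1.
apply: (triple_call_seq (load_spec (n := 2 ^ k) (c := k) (so := 0) (bs := 1) (bo := 4)
   (oo := 0) (m := m2) (x := y) Hload k0 _ _ _)) => //.
- move=> o lt_o; rewrite /cell keep2 ?s1 // old // add0n.
  by apply: Vy; apply: row_major_index_lt.
- by rewrite keep2 ?s1 // new.
- by rewrite /= e4.
- exact: (lt_m2 2).
- exact: lt_m2.
move=> ? m3 Hy [K3 _]; have [le3 _ keep3] := K3.
have lt_m3 b : b < 6 -> b < size m3 by move=> /lt_m2 lt_b; apply: leq_trans le3.
apply: (triple_call_seq (Hmul m3 3 4 5 0 f g _ _ _ _ _)) => //.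
- by move=> o lt_o; rewrite /cell keep3 ?lt_m2 //; have := Hx o lt_o; rewrite !add0n.
- by rewrite keep3 ?lt_m2 // keep2 ?s1 // new.
- exact: (lt_m3 2).
- exact: lt_m3.
move=> ? m4 HX [K4 _]; have [le4 _ keep4] := K4.
have lt_m4 b : b < 6 -> b < size m4 by move=> /lt_m3 lt_b; apply: leq_trans le4.
have lt_s i j : i < 2 ^ k -> j < 2 ^ k -> 2 * spread k i + spread k j < 4 ^ k.
  exact: spread2_lt.
apply: (triple_pure (l := [:: _])); first reflexivity.
apply: (triple_call (store_spec (k := k) (c := k) (so := 0) (bs := 5) (bo := 2) (oo := 0)
   (m := m4) (x := sv k f g) Hrow Hstore _ _ _)) => //.
- by move=> i j lt_i lt_j; rewrite add0n; have := HX _ (lt_s i j lt_i lt_j); rewrite add0n.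
- by rewrite keep4 ?lt_m3 // keep3 ?lt_m2 // keep2 ?s1 // old // sz2.
- by rewrite /= mul2n -addnn e4.
- exact: (lt_m4 2).
- exact: lt_m4.
- by rewrite /sub_writes eqxx /= leqnn.
Qed.
End Main.

(** * Correspondence with Strassen's algorithm *)

Section Matrices.
Variable R : nzRingType.
Implicit Types f g h : nat -> R.
Local Open Scope ring_scope.

Definition represents k f (A : 'M[R]_(2 ^ k)) : Prop :=
  forall i j : 'I_(2 ^ k), f (2 * spread k i + spread k j)%N = A i j.

Lemma mulrz_signs (a : R) : (a *~ Posz 0 = 0) * (a *~ Posz 1 = a) * (a *~ Negz 0 = - a).
Proof. by []. Qed.

Lemma represents_blocks k f (A : 'M[R]_(2 ^ k.+1)) : represents f A ->
  [/\ represents (fun o => f (o + 0 * 4 ^ k)%N) (ulsubmx (split2 A)),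
      represents (fun o => f (o + 1 * 4 ^ k)%N) (ursubmx (split2 A)),
      represents (fun o => f (o + 2 * 4 ^ k)%N) (dlsubmx (split2 A)) &
      represents (fun o => f (o + 3 * 4 ^ k)%N) (drsubmx (split2 A))].
Proof.
move=> H; have E (a b : bool) (i j i' j' : nat) : (i < 2 ^ k)%N -> (j < 2 ^ k)%N ->
    i' = (a * 2 ^ k + i)%N -> j' = (b * 2 ^ k + j)%N ->
    (2 * spread k i + spread k j + (2 * a + b) * 4 ^ k)%N =
    (2 * spread k.+1 i' + spread k.+1 j')%N.
  by move=> lt_i lt_j -> ->; rewrite !spreadD //; lia.
split=> i j; rewrite !mxE castmxE -H.
- by rewrite (E false false _ _ i j).
- by rewrite (E false true _ _ i (2 ^ k + j)%N) // mul1n.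
- by rewrite (E true false _ _ (2 ^ k + i)%N j) // mul1n.
- by rewrite (E true true _ _ (2 ^ k + i)%N (2 ^ k + j)%N) // mul1n.
Qed.

Lemma represents_join k h (A B C D : 'M[R]_(2 ^ k)) :
  represents (fun o => h (o + 0 * 4 ^ k)%N) A ->
  represents (fun o => h (o + 1 * 4 ^ k)%N) B ->
  represents (fun o => h (o + 2 * 4 ^ k)%N) C ->
  represents (fun o => h (o + 3 * 4 ^ k)%N) D ->
  represents h (join2 (block_mx A B C D)).
Proof.
move=> HA HB HC HD i j; rewrite castmxE.
have E (a b : bool) (i1 j1 : 'I_(2 ^ k)) : i = (a * 2 ^ k + i1)%N :> nat ->
    j = (b * 2 ^ k + j1)%N :> nat ->
    (2 * spread k.+1 i + spread k.+1 j)%N =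
    (2 * spread k i1 + spread k j1 + (2 * a + b) * 4 ^ k)%N.
  by move=> -> ->; rewrite !spreadD //; lia.
rewrite !mxE; case: splitP => i1 /= ei; rewrite mxE; case: splitP => j1 /= ej.
- by rewrite -HA (E false false i1 j1).
- by rewrite -HB (E false true i1 j1) ?mul1n.
- by rewrite -HC (E true false i1 j1) ?mul1n.
- by rewrite -HD (E true true i1 j1) ?mul1n.
Qed.

(** Both recursions list the products in the same order, so the permutation asked for is an
    equality. Only sums are commuted: the ring need not be commutative. *)
Lemma strassen_represents k f g (U V : 'M[R]_(2 ^ k)) :
  represents f U -> represents g V ->
  represents (sv k f g) (strassen U V).1 /\ svp k f g = strassen_products U V.
Proof.
rewrite /strassen_products; elim: k f g U V => [|k IH] f g U V HU HV.
  rewrite /= -HU -HV /=; split=> // i j.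
  by rewrite !ord1 mxE eqxx mulr1n.
have [U1 U2 U3 U4] := represents_blocks HU.
have [V1 V2 V3 V4] := represents_blocks HV.
rewrite /=; move: U1 U2 U3 U4 V1 V2 V3 V4.
set A11 := ulsubmx (split2 U); set A12 := ursubmx (split2 U).
set A21 := dlsubmx (split2 U); set A22 := drsubmx (split2 U).
set B11 := ulsubmx (split2 V); set B12 := ursubmx (split2 V).
set B21 := dlsubmx (split2 V); set B22 := drsubmx (split2 V).
clearbody A11 A12 A21 A22 B11 B12 B21 B22 => U1 U2 U3 U4 V1 V2 V3 V4.
have linE (K : seq (seq int)) p h o : lin K p (4 ^ k) h o =
    h (o + 0 * 4 ^ k)%N *~ coef K p 0 + h (o + 1 * 4 ^ k)%N *~ coef K p 1 +
    h (o + 2 * 4 ^ k)%N *~ coef K p 2 + h (o + 3 * 4 ^ k)%N *~ coef K p 3.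
  by rewrite /lin !big_nat_recl // big_geq // addr0 !addrA.
have H1 : represents (lin tabA 0 (4 ^ k) f) (A11 + A22) /\
    represents (lin tabB 0 (4 ^ k) g) (B11 + B22).
  by split=> i j; rewrite linE !mulrz_signs mxE -?U1 -?U4 -?V1 -?V4 !addr0.
have H2 : represents (lin tabA 1 (4 ^ k) f) (A21 + A22) /\
    represents (lin tabB 1 (4 ^ k) g) B11.
  by split=> i j; rewrite linE !mulrz_signs ?mxE -?U3 -?U4 -?V1 ?add0r ?addr0.
have H3 : represents (lin tabA 2 (4 ^ k) f) A11 /\
    represents (lin tabB 2 (4 ^ k) g) (B12 - B22).
  by split=> i j; rewrite linE !mulrz_signs ?mxE -?U1 -?V2 -?V4 ?add0r ?addr0.
have H4 : represents (lin tabA 3 (4 ^ k) f) A22 /\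
    represents (lin tabB 3 (4 ^ k) g) (B21 - B11).
  split=> i j; rewrite linE !mulrz_signs ?mxE -?U4 -?V1 -?V3 ?add0r ?addr0 //.
  by rewrite addrC.
have H5 : represents (lin tabA 4 (4 ^ k) f) (A11 + A12) /\
    represents (lin tabB 4 (4 ^ k) g) B22.
  by split=> i j; rewrite linE !mulrz_signs ?mxE -?U1 -?U2 -?V4 ?add0r ?addr0.
have H6 : represents (lin tabA 5 (4 ^ k) f) (A21 - A11) /\
    represents (lin tabB 5 (4 ^ k) g) (B11 + B12).
  split=> i j; rewrite linE !mulrz_signs ?mxE -?U1 -?U3 -?V1 -?V2 ?add0r ?addr0 //.
  by rewrite addrC.
have H7 : represents (lin tabA 6 (4 ^ k) f) (A12 - A22) /\
    represents (lin tabB 6 (4 ^ k) g) (B21 + B22).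
  by split=> i j; rewrite linE !mulrz_signs ?mxE -?U2 -?U4 -?V3 -?V4 ?add0r ?addr0.
have {H1} := IH _ _ _ _ H1.1 H1.2; have {H2} := IH _ _ _ _ H2.1 H2.2.
have {H3} := IH _ _ _ _ H3.1 H3.2; have {H4} := IH _ _ _ _ H4.1 H4.2.
have {H5} := IH _ _ _ _ H5.1 H5.2; have {H6} := IH _ _ _ _ H6.1 H6.2.
have {H7} := IH _ _ _ _ H7.1 H7.2.
do 7!case: (strassen _ _) => ? ? /=.
move=> [M7 ->] [M6 ->] [M5 ->] [M4 ->] [M3 ->] [M2 ->] [M1 ->].
split; last by rewrite cats0.
apply: represents_join => i j;
  have lt_ij := spread2_lt (ltn_ord i) (ltn_ord j);
  rewrite addnC divnMDl ?expn_gt0 // divn_small // modnMDl modn_small //;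
  rewrite !big_nat_recl // big_geq // !mulrz_signs !mxE
    -?M1 -?M2 -?M3 -?M4 -?M5 -?M6 -?M7 ?add0r ?addr0 ?addrA //.
Qed.
End Matrices.

(** * Row-major storage of matrices *)

Section RowMajor.
Local Open Scope nat_scope.
Variable R : nzRingType.

Lemma size_row_major n (A : 'M[R]_n) : size (row_major A) = n * n.
Proof. by rewrite size_allpairs -cardE card_ord. Qed.

Lemma nth_row_major n (A : 'M[R]_n) (i j : 'I_n) :
  nth Undef (row_major A) (i * n + j) = Scal (A i j).
Proof.
have := @nth_allpairs _ _ _ (fun i j => Scal (A i j)) Undef i j (enum 'I_n) (enum 'I_n) i j.
by rewrite size_enum_ord !nth_ord_enum => ->.
Qed.

Lemma vec_row_major n (A : 'M[R]_n) (m : memory R) b : blk m b = row_major A ->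
  vec m b (n * n) (fun o => scal_of (nth Undef (row_major A) o)).
Proof.
rewrite /vec /cell => -> o lt_o.
have n0 : 0 < n by case: n lt_o A.
have lt_i : o %/ n < n by rewrite ltn_divLR.
have lt_j : o %% n < n by rewrite ltn_mod.
by rewrite (divn_eq o n) (nth_row_major A (Ordinal lt_i) (Ordinal lt_j)).
Qed.
End RowMajor.

(** The numerals are positions in the list. Callees are fixed in the code, so each of the three
    tables gets its own copy of [entries_body]. *)
Definition strassen_program : program :=
  [:: main_body 1 2 4 15 6; log_body 1; pow_body 2 2; pow_body 3 3; load_body 4;
      store_row_body 5; store_body 5 6;
      eval_body 4 2 tabA 7; eval_body 4 2 tabB 8; eval_body 7 3 tabC 9;
      entries_body 7 10; entries_body 8 11; entries_body 9 12;
      outputs_body 12 13; products_body 10 11 15 14; multiply_body 2 3 14 13]%N.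

Lemma strassen_program_run (k : nat) (R : nzRingType) (U V : 'M[R]_(2 ^ k))
    (X0 : seq (value R)) :
  size X0 = (2 ^ k * 2 ^ k)%N ->
  exists (m : memory R) (d : dag R),
    [/\ run strassen_program U V X0 m d, race_free d,
        nth [::] m 2 = row_major (U *m V),
        products d = strassen_products U V &
        (cost d <= 500 * 66 * 7 ^ k)%N /\ (dag_span d <= 2000 * k.+1)%N].
Proof.
move=> sX.
pose m0 : memory R := [:: row_major U; row_major V; X0].
have [|||||||||||km [sm [Hm lek les]]] := @multiplies_all R strassen_program 7 10 8 11 9 12
  15 2 3 14 13 k; try reflexivity.
pose x o := scal_of (nth Undef (row_major U) o).
pose y o := scal_of (nth Undef (row_major V) o).
have Rx : represents (fun o => x (row_major_index (2 ^ k) k o)) U.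
  by move=> i j; rewrite row_major_index_spread // /x nth_row_major.
have Ry : represents (fun o => y (row_major_index (2 ^ k) k o)) V.
  by move=> i j; rewrite row_major_index_spread // /y nth_row_major.
have [HUV Hps] := strassen_represents Rx Ry.
have pr := main_spec (P := strassen_program) (flog := 1) (fpow4 := 2) (fload := 4)
  (frow := 5) (fstore := 6) (fmul := 15) (erefl _) (erefl _) (erefl _) (erefl _)
  (erefl _) (erefl _) Hm (erefl 3%N : size m0 = 3%N)
  (vec_row_major (erefl : blk m0 0 = row_major U))
  (vec_row_major (erefl : blk m0 1 = row_major V)) sX.
have [|||r [m [d [X rf _ [C S p [Hc K]]]]]] := triple_call (N := 3%N) (rb := [:: 0; 1]%N)
  (wb := 2) (lo := 0) (len := (2 ^ k * 2 ^ k)%N)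
  (r := frame [:: Word (2 ^ k); Ptr 0 0; Ptr 1 0; Ptr 2 0]) (y := 0) (xs := [:: 0; 1; 2; 3]%N)
  (Q := fun _ m' => (forall i j : 'I_(2 ^ k), cell m' 2 (i * 2 ^ k + j) = Scal ((U *m V) i j))
     /\ keeps 2 m0 m') pr (erefl _) (leqnn _) (isT : 2 < size m0)%N.
- by [].
- by rewrite /sub_writes eqxx !leqnn.
- move=> v m' E [K _]; split=> // i j.
  by rewrite E // -strassen_correct -HUV.
exists m, d; split.
- by exists r.
- exact: rf.
- have [_ sz _] := K; apply: (@eq_from_nth _ Undef).
    by rewrite -/(blk m 2) sz size_row_major -sX.
  rewrite -/(blk m 2) sz => o; rewrite [size _]sX => lt_o.
  have k0 : (0 < 2 ^ k)%N by rewrite expn_gt0.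
  have lt_i : (o %/ 2 ^ k < 2 ^ k)%N by rewrite ltn_divLR.
  have lt_j : (o %% 2 ^ k < 2 ^ k)%N by rewrite ltn_mod.
  rewrite (divn_eq o (2 ^ k)) -/(cell m 2 _).
  by rewrite (nth_row_major _ (Ordinal lt_i) (Ordinal lt_j)) -Hc.
- by rewrite p Hps.
split.
(* The coefficients of 7^k add up to at most 500 * 64 + 5 + 200 + 2, below 500 * 66; the 200 pays
   for everything outside the multiplication. *)
- have h4 : (4 ^ k <= 7 ^ k)%N by apply: leq_expl.
  have h7 : (0 < 7 ^ k)%N by rewrite expn_gt0.
  move: C lek h4 h7; move: (cost d) (4 ^ k)%N (7 ^ k)%N (500 * 64 * 6 ^ k)%N.
  by clear; lia.
- by move: S les; move: (dag_span d); clear; lia.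
Qed.

(** * From powers of 7 to real exponents and logarithms *)

Section RealBounds.
Variable K : realType.

Lemma log2_exp (k : nat) : log2 ((2 ^ k)%N%:R : K) = k%:R.
Proof.
have l2 : ln 2%:R != 0 :> K by rewrite gt_eqF // ln_gt0 // ltr1n.
by rewrite /log2 natrX lnXn ?ltr0n // -[ln _ *+ k]mulr_natl mulfK.
Qed.

Lemma exp_omega (k : nat) : (2 ^ k)%N%:R `^ omega K = (7 ^ k)%N%:R.
Proof.
have l2 : ln 2%:R != 0 :> K by rewrite gt_eqF // ln_gt0 // ltr1n.
rewrite /powR pnatr_eq0 expn_eq0 /= natrX lnXn ?ltr0n // /omega /log2.
by rewrite -[ln 2 *+ k]mulr_natl mulrCA mulfVK // expRM_natl lnK ?natrX // posrE ltr0n.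
Qed.
End RealBounds.

Theorem theorem1 (K : realType) :
  exists (P : program) (c : K) (n0 : nat),
  forall (k : nat) (R : nzRingType) (U V : 'M[R]_(2 ^ k)) (X0 : seq (value R)),
  let n := (2 ^ k)%N in
  size X0 = (n * n)%N ->
  exists (m : memory R) (d : dag R),
    [/\ run P U V X0 m d,
        race_free d,
        nth [::] m 2 = row_major (U *m V),
        perm_eq (products d) (strassen_products U V) &
        (n0 <= n)%N ->
        [/\ (dag_work d)%:R <= c * (n%:R `^ omega K * log2 (log2 n%:R)),
            (dag_span d)%:R <= c * log2 n%:R &
            (dag_space d)%:R <= c * n%:R `^ omega K]].
Proof.
(* From n = 4 on, log2 (log2 n) is at least 1, so a bound of order 7^k suffices for the work. *)
exists strassen_program, (500 * 66)%N%:R, 4 => k R U V X0 n sX.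
have [m [d [Hrun rf Hm Hp [Hc Hs]]]] := strassen_program_run U V sX.
exists m, d; split; [exact: Hrun | exact: rf | exact: Hm | by rewrite Hp | move=> le_n].
have k2 : (2 <= k)%N by rewrite -(@leq_exp2l 2).
rewrite exp_omega !log2_exp.
have l2 : 0 < ln 2%:R :> K by rewrite ln_gt0 // ltr1n.
have ll : 1 <= log2 (k%:R : K).
  by rewrite /log2 ler_pdivlMr // mul1r ler_ln ?posrE ?ltr0n ?ler_nat // (leq_trans _ k2).
have [work space] : (dag_work d <= 500 * 66 * 7 ^ k)%N /\ (dag_space d <= 500 * 66 * 7 ^ k)%N.
  by split; apply: leq_trans Hc; rewrite /cost ?leq_addr ?leq_addl.
split.
- apply: (@le_trans _ _ ((500 * 66)%N%:R * (7 ^ k)%N%:R)); first by rewrite -natrM ler_nat.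
  by rewrite ler_wpM2l // ler_peMr.
- rewrite -natrM ler_nat; apply: leq_trans Hs _.
  by move: k2; clear; lia.
- by rewrite -natrM ler_nat.
Qed.
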